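(* The implication problem for regular graph constraints over the class of heaps is undecidable: there is no algorithm that, given two graphs $G_1$ and $G_2$, decides whether $G_1 \leadsto_{\mathcal H} G_2$ holds, i.e. whether for every heap $H$, $H \to G_1$ implies $H \to G_2$.
   Context: A graph is a tuple $G=\langle V,s_1,s_2,\mathsf{null},\mathsf{root}\rangle$ where $V$ is a finite set of nodes, $\mathsf{root},\mathsf{null}\in V$ with $\mathsf{root}\neq\mathsf{null}$, $s_1,s_2\subseteq V\times V$, and for $i\in\{1,2\}$ and all $x\in V$: $\langle \mathsf{null},x\rangle\in s_i$ iff $x=\mathsf{null}$. A heap is a graph in which $s_1$ and $s_2$ are total functions $V\to V$ and every node $x\neq\mathsf{null}$ is reachable from $\mathsf{root}$ along edges of $s_1\cup s_2$; $\mathcal H$ denotes the class of heaps. A homomorphism from $G=\langle V,s_1,s_2,\mathsf{null},\mathsf{root}\rangle$ to $G'=\langle V',s_1',s_2',\mathsf{null}',\mathsf{root}'\rangle$ is a function $h:V\to V'$ such that (1) $\langle x,y\rangle\in s_i$ implies $\langle h(x),h(y)\rangle\in s_i'$ for $i\in\{1,2\}$; (2) $h(x)=\mathsf{root}'$ iff $x=\mathsf{root}$; (3) $h(x)=\mathsf{null}'$ iff $x=\mathsf{null}$. We write $G\to G'$ if such a homomorphism exists. *)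

(* Defs.v *)
From Stdlib Require Import Arith List.
Import ListNotations.

(** * Finite graphs, concretely represented.
    A graph has node set V = {0, ..., gn-1}; the relations s1, s2 are given
    as lists of pairs (membership = edge); null and root are nodes. *)
Record graph : Type := mkGraph {
  gn : nat;
  gs1 : list (nat * nat);
  gs2 : list (nat * nat);
  gnull : nat;
  groot : nat
}.

Definition edge (G : graph) (i : nat) (x y : nat) : Prop :=
  match i with
  | 1 => In (x, y) (gs1 G)
  | _ => In (x, y) (gs2 G)
  end.

Definition wf_graph (G : graph) : Prop :=
  gnull G < gn G /\ groot G < gn G /\ gnull G <> groot G /\
  (forall i x y, (i = 1 \/ i = 2) -> edge G i x y -> x < gn G /\ y < gn G) /\
  (forall i x, (i = 1 \/ i = 2) -> x < gn G ->
     (edge G i (gnull G) x <-> x = gnull G)).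

Inductive reach (G : graph) : nat -> Prop :=
  | reach_root : reach G (groot G)
  | reach_step : forall i x y, (i = 1 \/ i = 2) -> reach G x -> edge G i x y -> reach G y.

Definition is_heap (H : graph) : Prop :=
  wf_graph H /\
  (forall i x, (i = 1 \/ i = 2) -> x < gn H ->
     exists y, edge H i x y /\ forall y', edge H i x y' -> y' = y) /\
  (forall x, x < gn H -> x <> gnull H -> reach H x).

Definition is_hom (G G' : graph) (h : nat -> nat) : Prop :=
  (forall x, x < gn G -> h x < gn G') /\
  (forall i x y, (i = 1 \/ i = 2) -> edge G i x y -> edge G' i (h x) (h y)) /\
  (forall x, x < gn G -> (h x = groot G' <-> x = groot G)) /\
  (forall x, x < gn G -> (h x = gnull G' <-> x = gnull G)).

Definition hom_exists (G G' : graph) : Prop := exists h, is_hom G G' h.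

Definition implies_heaps (G1 G2 : graph) : Prop :=
  forall H, is_heap H -> hom_exists H G1 -> hom_exists H G2.

(** * Encoding graphs as natural numbers (Cantor pairing). *)
Definition cpair (a b : nat) : nat := (a + b) * (a + b + 1) / 2 + b.

Fixpoint enc_pairs (l : list (nat * nat)) : nat :=
  match l with
  | [] => 0
  | (a, b) :: l' => S (cpair (cpair a b) (enc_pairs l'))
  end.

Definition enc_graph (G : graph) : nat :=
  cpair (gn G) (cpair (enc_pairs (gs1 G))
    (cpair (enc_pairs (gs2 G)) (cpair (gnull G) (groot G)))).

Definition enc_instance (G1 G2 : graph) : nat := cpair (enc_graph G1) (enc_graph G2).

(** * Model of computation: Minsky register machines (Turing complete). *)
Inductive instr : Type :=
  | INC (r : nat)
  | DEC (r : nat) (j : nat).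

Definition state : Type := (nat * (nat -> nat))%type.

Definition upd (f : nat -> nat) (r v : nat) : nat -> nat :=
  fun k => if Nat.eqb k r then v else f k.

Definition step (p : list instr) (s : state) : state :=
  let (pc, regs) := s in
  match nth_error p pc with
  | None => s
  | Some (INC r) => (S pc, upd regs r (S (regs r)))
  | Some (DEC r j) =>
      match regs r with
      | 0 => (j, regs)
      | S v => (S pc, upd regs r v)
      end
  end.

Definition run (p : list instr) (k : nat) (s : state) : state := Nat.iter k (step p) s.

Definition init_state (x : nat) : state := (0, fun r => if Nat.eqb r 0 then x else 0).

Definition halted (p : list instr) (s : state) : Prop := length p <= fst s.

Definition outputs (p : list instr) (x : nat) (b : bool) : Prop :=
  exists k, halted p (run p k (init_state x)) /\
            snd (run p k (init_state x)) 0 = (if b then 1 else 0).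

Definition decides_heap_implication (p : list instr) : Prop :=
  forall G1 G2, wf_graph G1 -> wf_graph G2 ->
    exists b : bool, outputs p (enc_instance G1 G2) b /\
                     (b = true <-> implies_heaps G1 G2).

(* Main.v *)
From Stdlib Require Import Arith List Lia Bool FunctionalExtensionality Classical.
Require Import Defs.
Import ListNotations.

(* From a program [q] and an input [x > 0] we build graphs [G1], depending on [q]
   and [x], and [G2], depending on [q] only, such that some heap maps to [G1] but
   not to [G2] iff [q] halts on [x].  The heap in question writes the computation
   as an s1-linked list of cells, [k] consecutive cells forming a configuration;
   the s2-pointer of a cell is the content of a register, a number being an
   s1-chain of that length that ends in null.  Local conditions (control flow, tests
   for 0, the initial configuration) are imposed by [G1].  What [G1] cannot impose is
   that contents [k] cells apart are related by an equality of nodes or by one s1-step.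
   So [G2] is made to accept exactly the lists with an error: two nodes are distinct
   iff they can be given different colours, hence a homomorphism to [G2] may guess the
   position of a wrong update and colour the nodes involved.  Homomorphisms being
   coinductive, a cyclic list is also accepted by [G2] (the guess is postponed forever),
   so counterexamples are finite, correct and complete computations.

   If [p] decided the implication, a program could build the instance made from a
   code given as input, run [p] on it, and halt iff [p] answers yes; running
   this program on its own code is contradictory. *)

(** * Programming register machines *)

(** A homomorphism condition on an s2-pointer sees only the label of the content it points to. So
    the label of a numeral carries the colour of its s1-successor, that is, of its predecessor as a
    number; this is enough because an instruction changes a register by at most one. Two non-null
    colours suffice: one expected node is set against all the others, and null, which every
    homomorphism recognises, has a colour to itself. The guess is stored in all cells of a block
    because the test takes place at the cell of one register, while the jump is chosen at the last
    cell. The width [k] exceeds all register indices of the program, so a block is a full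
    configuration. The diagonal argument needs neither an interpreter nor a computable construction
    of the graphs from a program. The code handed to the program is that of the finished part of its
    own instance, mostly lists of edges; what depends on the input is only the chain of numerals and
    the edges into it, and these are prepended by loops. Hence the split of [G1] into a fixed list
    of edges and the chains. *)

Definition steps (P : list instr) (s s' : state) : Prop := exists n, run P n s = s'.

Lemma steps_refl P s : steps P s s.
Proof. now exists 0. Qed.

Lemma steps_trans P s1 s2 s3 : steps P s1 s2 -> steps P s2 s3 -> steps P s1 s3.
Proof.
  intros [n <-] [m <-]. exists (m + n). unfold run. apply Nat.iter_add.
Qed.

Lemma steps_one P s s' : step P s = s' -> steps P s s'.
Proof. intros H. now exists 1. Qed.

Definition code_at (P : list instr) (a : nat) (c : list instr) : Prop :=
  forall i x, nth_error c i = Some x -> nth_error P (a + i) = Some x.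

Lemma code_at_app P a c1 c2 :
  code_at P a (c1 ++ c2) -> code_at P a c1 /\ code_at P (a + length c1) c2.
Proof.
  intros H; split; intros i x Hi.
  - apply H. rewrite nth_error_app1; auto.
    apply nth_error_Some. congruence.
  - rewrite <- Nat.add_assoc. apply H.
    rewrite nth_error_app2 by lia. now replace (length c1 + i - length c1) with i by lia.
Qed.

Lemma code_at_cons P a x c :
  code_at P a (x :: c) -> nth_error P a = Some x /\ code_at P (S a) c.
Proof.
  intros H; split.
  - rewrite <- (Nat.add_0_r a). now apply H.
  - intros i y Hi. replace (S a + i) with (a + S i) by lia. now apply H.
Qed.

(** [Loop r] decrements [r] before each pass because [DEC] tests and decrements in one
    instruction. *)
Inductive cmd : Type :=
  | Skip
  | Incr (r : nat)
  | Decr (r : nat)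
  | Seq (c1 c2 : cmd)
  | Loop (r : nat) (c : cmd).

Inductive exec : cmd -> (nat -> nat) -> (nat -> nat) -> Prop :=
  | exec_Skip s : exec Skip s s
  | exec_Incr r s : exec (Incr r) s (upd s r (S (s r)))
  | exec_Decr r s : exec (Decr r) s (upd s r (pred (s r)))
  | exec_Seq c1 c2 s s' s'' : exec c1 s s' -> exec c2 s' s'' -> exec (Seq c1 c2) s s''
  | exec_Loop0 r c s : s r = 0 -> exec (Loop r c) s s
  | exec_LoopS r c s v s' s'' : s r = S v -> exec c (upd s r v) s' ->
      exec (Loop r c) s' s'' -> exec (Loop r c) s s''.

(* The machine has no unconditional jump: it is simulated by testing a
   register [z] that always holds 0. *)
Fixpoint compile (z a : nat) (c : cmd) : list instr :=
  match c with
  | Skip => []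
  | Incr r => [INC r]
  | Decr r => [DEC r (S a)]
  | Seq c1 c2 => let l1 := compile z a c1 in l1 ++ compile z (a + length l1) c2
  | Loop r c =>
      let l := compile z (S a) c in DEC r (a + length l + 2) :: l ++ [DEC z a]
  end.

Fixpoint max_reg (c : cmd) : nat :=
  match c with
  | Skip => 0
  | Incr r | Decr r => r
  | Seq c1 c2 => Nat.max (max_reg c1) (max_reg c2)
  | Loop r c => Nat.max r (max_reg c)
  end.

Lemma exec_frame c s s' z : exec c s s' -> max_reg c < z -> s' z = s z.
Proof.
  induction 1; cbn [max_reg]; intros Hz; auto.
  - unfold upd. destruct (Nat.eqb_spec z r); auto; lia.
  - unfold upd. destruct (Nat.eqb_spec z r); auto; lia.
  - rewrite IHexec2, IHexec1 by lia. reflexivity.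
  - rewrite IHexec2 by (cbn [max_reg]; lia). rewrite IHexec1 by lia.
    unfold upd. destruct (Nat.eqb_spec z r); auto; lia.
Qed.

Lemma compile_correct P z c s s' a :
  exec c s s' -> max_reg c < z -> s z = 0 -> code_at P a (compile z a c) ->
  steps P (a, s) (a + length (compile z a c), s').
Proof.
  intros He; revert a; induction He; intros a Hm Hz Hc; cbn [compile max_reg] in *.
  - rewrite Nat.add_0_r. apply steps_refl.
  - apply code_at_cons in Hc as [Hc _]. apply steps_one. cbn. rewrite Hc.
    now rewrite Nat.add_1_r.
  - apply code_at_cons in Hc as [Hc _]. apply steps_one. cbn. rewrite Hc, Nat.add_1_r.
    destruct (s r) eqn:E; [|reflexivity].
    (* A [DEC] that finds 0 leaves the registers alone, while [exec] writes 0 over 0: the two states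
       agree only by extensionality. *)
    f_equal. extensionality k. unfold upd. destruct (Nat.eqb_spec k r); subst; auto.
  - apply code_at_app in Hc as [Hc1 Hc2].
    eapply steps_trans; [apply IHHe1; auto; lia|].
    rewrite length_app, Nat.add_assoc. apply IHHe2; auto; try lia.
    rewrite (exec_frame _ _ _ _ He1) by lia; auto.
  - apply code_at_cons in Hc as [Hc _]. apply steps_one. cbn [step]. rewrite Hc, H.
    f_equal. cbn. rewrite length_app. cbn. lia.
  - assert (Hc' := Hc).
    apply code_at_cons in Hc as [Hd Hc]. apply code_at_app in Hc as [Hb Hj].
    apply code_at_cons in Hj as [Hj _].
    eapply steps_trans; [apply steps_one; cbn [step]; rewrite Hd, H; reflexivity|].
    assert (Hz1 : upd s r v z = 0).
    { unfold upd. destruct (Nat.eqb_spec z r); auto; lia. }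
    eapply steps_trans; [apply IHHe1; auto; lia|].
    assert (Hz2 : s' z = 0).
    { rewrite (exec_frame _ _ _ _ He1) by lia; auto. }
    eapply steps_trans; [apply steps_one; cbn [step]; rewrite Hj, Hz2; reflexivity|].
    now apply IHHe2.
Qed.

Ltac regs_at :=
  unfold upd;
  repeat match goal with
  | |- context [Nat.eqb ?x ?x] => rewrite (Nat.eqb_refl x)
  | |- context [Nat.eqb ?x ?y] => destruct (Nat.eqb_spec x y); subst; try lia
  end.

Ltac regs_eq := extensionality k; regs_at.

Lemma exec_clear s r : exec (Loop r Skip) s (upd s r 0).
Proof.
  remember (s r) as n eqn:E. revert s E.
  induction n as [|n IH]; intros s E.
  - replace (upd s r 0) with s by regs_eq. now constructor.
  - eapply exec_LoopS; [symmetry; exact E|constructor|].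
    replace (upd s r 0) with (upd (upd s r n) r 0) by regs_eq.
    apply IH. unfold upd. now rewrite Nat.eqb_refl.
Qed.

Definition move a b := Loop a (Incr b).

Lemma exec_move a b s : a <> b -> exec (move a b) s (upd (upd s b (s b + s a)) a 0).
Proof.
  intros Hab. remember (s a) as n eqn:E. revert s E.
  induction n as [|n IH]; intros s E.
  - replace (upd (upd s b (s b + 0)) a 0) with s by regs_eq. now constructor.
  - eapply exec_LoopS; [symmetry; exact E|constructor|].
    match goal with |- exec _ ?x _ => set (s1 := x) end.
    replace (upd (upd s b (s b + S n)) a 0) with (upd (upd s1 b (s1 b + n)) a 0)
      by (unfold s1; regs_eq).
    apply IH. unfold s1. regs_at.
Qed.

(** Reading a register empties it, so its content is sent to two registers and moved back from the
    second. *)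
Definition copy i d := Seq (Loop i (Seq (Incr d) (Incr (S d)))) (move (S d) i).

Lemma exec_copy i d s : i < d -> s d = 0 -> s (S d) = 0 -> exec (copy i d) s (upd s d (s i)).
Proof.
  intros Hi H0 H1.
  assert (G : forall n t, t i = n ->
    exec (Loop i (Seq (Incr d) (Incr (S d)))) t
      (upd (upd (upd t d (t d + n)) (S d) (t (S d) + n)) i 0)).
  { induction n as [|n IH]; intros t E.
    - match goal with |- exec _ _ ?x => replace x with t by regs_eq end. now constructor.
    - eapply exec_LoopS; [exact E| econstructor; constructor|].
      match goal with |- exec _ ?x _ => set (s1 := x) end.
      match goal with |- exec _ _ ?x =>
        replace x with (upd (upd (upd s1 d (s1 d + n)) (S d) (s1 (S d) + n)) i 0)
          by (unfold s1; regs_eq) end.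
      apply IH. unfold s1. regs_at. }
  econstructor; [apply (G _ s eq_refl)|].
  match goal with |- exec _ ?x _ => set (s1 := x) end.
  replace (upd s d (s i)) with (upd (upd s1 i (s1 i + s1 (S d))) (S d) 0).
  - apply exec_move. lia.
  - unfold s1. regs_eq.
Qed.

(** * Computable functions *)

(* [down n f a] is [f 0 (f 1 (... (f (n-1) a)))]: primitive recursion with a
   descending counter, which is what a loop on a register computes. *)
Fixpoint down {A : Type} (n : nat) (f : nat -> A -> A) (a : A) : A :=
  match n with
  | 0 => a
  | S n' => down n' f (f n' a)
  end.

(* The arguments of [f] may live in arbitrary registers [rho]; the registers
   from [d] on are scratch space, and the value is delivered in register [d]. *)
Definition computable (f : list nat -> nat) : Prop :=
  forall rho d, (forall r, In r rho -> r < d) ->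
  exists c, forall s, (forall r, d <= r -> s r = 0) -> exec c s (upd s d (f (map s rho))).

Lemma map_upd s d v rho :
  (forall r, In r rho -> r < d) -> map (upd s d v) rho = map s rho.
Proof.
  intros H. apply map_ext_in. intros r Hr. apply H in Hr. unfold upd.
  destruct (Nat.eqb_spec r d); auto; lia.
Qed.

Lemma upd_scratch s d v r : (forall r, d <= r -> s r = 0) -> S d <= r -> upd s d v r = 0.
Proof.
  intros H Hr. unfold upd. destruct (Nat.eqb_spec r d); [lia|]. apply H. lia.
Qed.

Lemma computable_ext f g : (forall l, f l = g l) -> computable f -> computable g.
Proof.
  intros E Hf rho d Hr. destruct (Hf rho d Hr) as [c Hc]. exists c. intros s Hs.
  rewrite <- E. now apply Hc.
Qed.

Lemma computable_const0 : computable (fun _ => 0).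
Proof.
  intros rho d _. exists Skip. intros s Hs.
  replace (upd s d 0) with s; [constructor|].
  regs_eq. now apply Hs.
Qed.

Lemma computable_var i : computable (fun l => nth i l 0).
Proof.
  intros rho d Hr. destruct (Nat.lt_ge_cases i (length rho)) as [Hi|Hi].
  - exists (copy (nth i rho 0) d). intros s Hs.
    rewrite (nth_indep (map s rho) 0 (s 0)) by now rewrite length_map.
    rewrite map_nth. apply exec_copy; try apply Hs; try lia.
    now apply Hr, nth_In.
  - destruct (computable_const0 rho d Hr) as [c Hc]. exists c. intros s Hs.
    rewrite nth_overflow by now rewrite length_map. now apply Hc.
Qed.

Lemma computable_succ f : computable f -> computable (fun l => S (f l)).
Proof.
  intros Hf rho d Hr. destruct (Hf rho d Hr) as [c Hc].
  exists (Seq c (Incr d)). intros s Hs. econstructor; [now apply Hc|].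
  match goal with |- exec _ ?x ?y => replace y with (upd x d (S (x d))) end.
  - constructor.
  - regs_eq.
Qed.

Lemma computable_pred f : computable f -> computable (fun l => pred (f l)).
Proof.
  intros Hf rho d Hr. destruct (Hf rho d Hr) as [c Hc].
  exists (Seq c (Decr d)). intros s Hs. econstructor; [now apply Hc|].
  match goal with |- exec _ ?x ?y => replace y with (upd x d (pred (x d))) end.
  - constructor.
  - regs_eq.
Qed.

Lemma computable_tl f : computable f -> computable (fun l => f (tl l)).
Proof.
  intros Hf rho d Hr. destruct (Hf (tl rho) d) as [c Hc].
  - intros r H. apply Hr. destruct rho; cbn in *; auto.
  - exists c. intros s Hs.
    replace (tl (map s rho)) with (map s (tl rho)) by now destruct rho. now apply Hc.
Qed.

(** This is the composition principle. Since arguments are addressed through [rho], an intermediate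
    value becomes one more argument without moving the others: [d] is simply put in front of
    [rho]. *)
Lemma computable_let f g :
  computable f -> computable g -> computable (fun l => g (f l :: l)).
Proof.
  intros Hf Hg rho d Hr. destruct (Hf rho d Hr) as [c Hc].
  destruct (Hg (d :: rho) (S d)) as [c' Hc'].
  { intros r [<-|H]; [lia|]. apply Hr in H. lia. }
  exists (Seq c (Seq c' (Seq (Loop d Skip) (move (S d) d)))). intros s Hs.
  econstructor; [now apply Hc|].
  set (s1 := upd s d (f (map s rho))).
  econstructor; [apply Hc'; intros r H; now apply upd_scratch|].
  cbn [map]. unfold s1 at 2 3. rewrite map_upd by auto.
  replace (upd s d (f (map s rho)) d) with (f (map s rho))
    by (unfold upd; now rewrite Nat.eqb_refl).
  econstructor; [apply exec_clear|].
  match goal with |- exec _ ?x ?y =>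
    replace y with (upd (upd x d (x d + x (S d))) (S d) 0) end.
  - apply exec_move. lia.
  - unfold s1. regs_eq. rewrite Hs; lia.
Qed.

(** Register [d] is the counter, [S d] the accumulator and [S (S d)] receives the value of a step.
    As [Loop] decrements first, the body sees in [d] exactly the index that [down] passes to its
    step. *)
Lemma computable_down fn f0 (fs : nat -> nat -> list nat -> nat) :
  computable fn -> computable f0 ->
  computable (fun l => fs (nth 0 l 0) (nth 1 l 0) (tl (tl l))) ->
  computable (fun l => down (fn l) (fun j v => fs j v l) (f0 l)).
Proof.
  intros Hn H0 Hs rho d Hr. destruct (Hn rho d Hr) as [cn Hcn].
  destruct (H0 rho (S d)) as [c0 Hc0].
  { intros r H. apply Hr in H. lia. }
  destruct (Hs (d :: S d :: rho) (S (S d))) as [cs Hcs].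
  { intros r [<-|[<-|H]]; try lia. apply Hr in H. lia. }
  exists (Seq cn (Seq c0 (Seq (Loop d (Seq cs (Seq (Loop (S d) Skip) (move (S (S d)) (S d)))))
                              (move (S d) d)))).
  intros s Hz. econstructor; [now apply Hcn|].
  econstructor; [apply Hc0; intros r H; now apply upd_scratch|].
  rewrite map_upd by auto.
  set (l := map s rho). generalize (fn l) (f0 l). intros n v.
  apply exec_Seq with (s' := upd (upd s d 0) (S d) (down n (fun j v => fs j v l) v)).
  - revert v. induction n as [|n IH]; intros v; cbn [down].
    + apply exec_Loop0. unfold upd.
      destruct (Nat.eqb_spec d (S d)); [lia|]. now rewrite Nat.eqb_refl.
    + eapply exec_LoopS; [| | apply IH].
      * unfold upd. destruct (Nat.eqb_spec d (S d)); [lia|]. now rewrite Nat.eqb_refl.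
      * set (s1 := upd (upd (upd s d (S n)) (S d) v) d n).
        assert (E1 : map s1 (d :: S d :: rho) = n :: v :: l).
        { unfold s1. cbn [map]. f_equal; [|f_equal].
          - unfold upd. now rewrite Nat.eqb_refl.
          - unfold upd. rewrite Nat.eqb_refl. destruct (Nat.eqb_spec (S d) d); lia.
          - apply map_ext_in. intros r H. apply Hr in H. unfold upd.
            destruct (Nat.eqb_spec r d); [lia|].
            destruct (Nat.eqb_spec r (S d)); lia. }
        econstructor.
        { apply Hcs. intros r H. unfold s1, upd.
          destruct (Nat.eqb_spec r d); [lia|]. destruct (Nat.eqb_spec r (S d)); [lia|].
          apply Hz. lia. }
        rewrite E1. cbn [nth tl].
        econstructor; [apply exec_clear|].
        match goal with |- exec _ ?x ?y =>
          replace y with (upd (upd x (S d) (x (S d) + x (S (S d)))) (S (S d)) 0) end.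
        -- apply exec_move. lia.
        -- unfold s1. regs_eq. rewrite Hz; lia.
  - match goal with |- exec _ ?x ?y =>
      replace y with (upd (upd x d (x d + x (S d))) (S d) 0) end.
    + apply exec_move. lia.
    + regs_eq. rewrite Hz; lia.
Qed.

Lemma computable_comp1 (h : nat -> nat) f :
  computable (fun l => h (nth 0 l 0)) -> computable f -> computable (fun l => h (f l)).
Proof. intros Hh Hf. exact (computable_let f _ Hf Hh). Qed.

Lemma computable_add f g :
  computable f -> computable g -> computable (fun l => f l + g l).
Proof.
  intros Hf Hg.
  apply computable_ext with (fun l => down (f l) (fun _ v => S v) (g l)).
  - intros l. generalize (g l). induction (f l) as [|n IH]; intros v; cbn; auto.
    rewrite IH. lia.
  - apply (computable_down f g (fun _ v _ => S v)); auto.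
    apply computable_succ, computable_var.
Qed.

Lemma computable_sub f g :
  computable f -> computable g -> computable (fun l => f l - g l).
Proof.
  intros Hf Hg.
  apply computable_ext with (fun l => down (g l) (fun _ v => pred v) (f l)).
  - intros l. generalize (f l). induction (g l) as [|n IH]; intros v; cbn; [lia|].
    rewrite IH. lia.
  - apply (computable_down g f (fun _ v _ => pred v)); auto.
    apply computable_pred, computable_var.
Qed.

Lemma computable_const n : computable (fun _ => n).
Proof. induction n; [apply computable_const0|now apply computable_succ]. Qed.

(** * Cantor pairing and its inverse as primitive recursions *)

Definition triangle n := down n (fun j v => S j + v) 0.

Lemma triangle_S n : triangle (S n) = S n + triangle n.
Proof.
  unfold triangle. cbn [down].
  assert (G : forall n v, down n (fun j v => S j + v) v = down n (fun j v => S j + v) 0 + v).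
  { clear. induction n as [|n IH]; intros v; cbn [down]; [lia|].
    rewrite IH, (IH (S n + 0)). lia. }
  rewrite G. lia.
Qed.

(** Triangular numbers replace the division in [cpair], for which there is no command. *)
Lemma cpair_triangle a b : cpair a b = triangle (a + b) + b.
Proof.
  unfold cpair. f_equal. generalize (a + b). intros n.
  apply (Nat.mul_cancel_r _ _ 2); [lia|].
  assert (E : n * (n + 1) = triangle n * 2).
  { induction n as [|n IH]; [reflexivity|]. rewrite triangle_S. nia. }
  now rewrite E, Nat.div_mul.
Qed.

Lemma computable_triangle f : computable f -> computable (fun l => triangle (f l)).
Proof.
  intros Hf. unfold triangle.
  apply (computable_down f (fun _ => 0) (fun j v _ => S j + v)); auto.
  - apply computable_const.
  - apply computable_add; [apply computable_succ|]; apply computable_var.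
Qed.

Lemma computable_cpair f g :
  computable f -> computable g -> computable (fun l => cpair (f l) (g l)).
Proof.
  intros Hf Hg.
  apply computable_ext with (fun l => triangle (f l + g l) + g l).
  - intros l. now rewrite cpair_triangle.
  - apply computable_add; auto. apply computable_triangle, computable_add; auto.
Qed.

(** This searches for the largest [s] with [triangle s <= n]: a step adds 1 as long as the next
    triangular number does not exceed [n]. By [le_triangle], [n] steps starting from 0 are
    enough. *)
Definition diagonal n := down n (fun _ s => s + (1 - (triangle (S s) - n))) 0.
Definition cproj2 n := n - triangle (diagonal n).
Definition cproj1 n := diagonal n - cproj2 n.

Lemma triangle_mono a b : a <= b -> triangle a <= triangle b.
Proof. induction 1; auto. rewrite triangle_S. lia. Qed.

Lemma le_triangle n : n <= triangle n.
Proof. induction n; [lia|]. rewrite triangle_S. lia. Qed.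

Lemma diagonal_cpair a b : diagonal (cpair a b) = a + b.
Proof.
  unfold diagonal. set (n := cpair a b).
  assert (En : n = triangle (a + b) + b) by apply cpair_triangle.
  assert (G : forall m s, s <= a + b -> a + b <= s + m ->
    down m (fun _ s => s + (1 - (triangle (S s) - n))) s = a + b).
  { induction m as [|m IH]; intros s H1 H2; cbn [down]; [lia|].
    destruct (Nat.eq_dec s (a + b)) as [->|Hs].
    - rewrite triangle_S. replace (1 - (S (a + b) + triangle (a + b) - n)) with 0 by lia.
      apply IH; lia.
    - assert (triangle (S s) <= triangle (a + b)) by (apply triangle_mono; lia).
      apply IH; lia. }
  apply G; [lia|]. pose proof (le_triangle (a + b)). lia.
Qed.

Lemma cproj2_cpair a b : cproj2 (cpair a b) = b.
Proof. unfold cproj2. rewrite diagonal_cpair, cpair_triangle. lia. Qed.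

Lemma cproj1_cpair a b : cproj1 (cpair a b) = a.
Proof. unfold cproj1. rewrite diagonal_cpair, cproj2_cpair. lia. Qed.

Lemma computable_diagonal f : computable f -> computable (fun l => diagonal (f l)).
Proof.
  apply (computable_comp1 diagonal). unfold diagonal.
  apply (computable_down (fun l => nth 0 l 0) (fun _ => 0)
           (fun _ s l => s + (1 - (triangle (S s) - nth 0 l 0)))).
  - apply computable_var.
  - apply computable_const.
  - apply computable_add; [apply computable_var|].
    apply computable_sub; [apply computable_const|].
    apply computable_sub.
    + apply computable_triangle, computable_succ, computable_var.
    + apply (computable_tl (fun l => nth 0 (tl l) 0)).
      apply (computable_tl (fun l => nth 0 l 0)), computable_var.
Qed.

Lemma computable_cproj2 f : computable f -> computable (fun l => cproj2 (f l)).
Proof.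
  intros Hf. unfold cproj2. apply computable_sub; auto.
  now apply computable_triangle, computable_diagonal.
Qed.

Lemma computable_cproj1 f : computable f -> computable (fun l => cproj1 (f l)).
Proof.
  intros Hf. unfold cproj1.
  apply computable_sub; [now apply computable_diagonal|now apply computable_cproj2].
Qed.

(** * Running a program on a computed input *)

Definition halts (p : list instr) (x : nat) : Prop :=
  exists k, halted p (run p k (init_state x)).

Lemma run_S p k s : run p (S k) s = step p (run p k s).
Proof. reflexivity. Qed.

Lemma step_halted p s : halted p s -> step p s = s.
Proof.
  destruct s as [pc regs]. unfold halted. cbn. intros H.
  now rewrite (proj2 (nth_error_None p pc) H).
Qed.

Lemma run_halted p k s : halted p s -> run p k s = s.
Proof.
  intros H. induction k as [|k IH]; auto. rewrite run_S, IH. now apply step_halted.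
Qed.

Lemma halted_run_le p s k k' : k <= k' -> halted p (run p k s) -> run p k' s = run p k s.
Proof.
  intros H Hh. replace k' with ((k' - k) + k) by lia. unfold run at 1. rewrite Nat.iter_add.
  now apply run_halted.
Qed.

Lemma steps_halted P s s' k :
  steps P s s' -> halted P (run P k s) -> exists k', halted P (run P k' s').
Proof.
  intros [n <-] H. exists k. unfold run at 1 2. rewrite <- Nat.iter_add.
  fold (run P (k + n) s). rewrite (halted_run_le P s k (k + n)); auto; lia.
Qed.

(** Registers move up by one because the computed input is delivered in register 1, register 0 still
    holding the original one. Jump targets are clipped since a program may halt at any address
    beyond its end, and all of these must become the address of the instruction that follows. *)
Definition reloc (off len : nat) (i : instr) : instr :=
  match i with
  | INC r => INC (S r)
  | DEC r j => DEC (S r) (off + Nat.min j len)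
  end.

Lemma reloc_sim P p off regs k s :
  code_at P off (map (reloc off (length p)) p) ->
  (forall r, regs (S r) = snd s r) -> fst s <= length p ->
  exists regs', (forall r, regs' (S r) = snd (run p k s) r) /\
    steps P (off + fst s, regs) (off + Nat.min (fst (run p k s)) (length p), regs').
Proof.
  intros Hc Hr Hs. induction k as [|k IH].
  - exists regs. split; auto. cbn. rewrite Nat.min_l by lia. apply steps_refl.
  - destruct IH as (regs' & Hr' & Hst). rewrite run_S.
    destruct (run p k s) as [pc t]. cbn [fst snd] in *.
    destruct (nth_error p pc) as [i|] eqn:E.
    + assert (Hpc : pc < length p) by (apply nth_error_Some; congruence).
      rewrite Nat.min_l in Hst by lia.
      assert (Hi : nth_error P (off + pc) = Some (reloc off (length p) i)).
      { apply Hc. now apply map_nth_error. }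
      destruct i as [r|r j].
      * exists (upd regs' (S r) (S (regs' (S r)))). split.
        -- intros r0. cbn. rewrite E. cbn. unfold upd. cbn. rewrite !Hr'. auto.
        -- eapply steps_trans; [exact Hst|]. apply steps_one. cbn [step].
           rewrite E, Hi. cbn [reloc fst].
           rewrite Nat.min_l by lia. f_equal. lia.
      * destruct (t r) as [|v] eqn:Er.
        -- exists regs'. split.
           ++ intros r0. cbn. rewrite E, Er. cbn. auto.
           ++ eapply steps_trans; [exact Hst|]. apply steps_one. cbn.
              rewrite E, Hi, Er. cbn. now rewrite Hr', Er.
        -- exists (upd regs' (S r) v). split.
           ++ intros r0. cbn. rewrite E, Er. cbn. unfold upd. cbn. rewrite Hr'. auto.
           ++ eapply steps_trans; [exact Hst|]. apply steps_one. cbn [step].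
              rewrite E, Hi, Er. cbn [reloc fst]. rewrite Hr', Er.
              rewrite Nat.min_l by lia. f_equal. lia.
    + exists regs'. rewrite step_halted; auto. now apply nth_error_None.
Qed.

Lemma code_at_mid l1 c l2 : code_at (l1 ++ c ++ l2) (length l1) c.
Proof.
  intros i x H. rewrite nth_error_app2 by lia.
  replace (length l1 + i - length l1) with i by lia.
  rewrite nth_error_app1; auto. apply nth_error_Some. congruence.
Qed.

(** The program computes [f], runs the relocated [p], and ends with [DEC 1 stop] at address [stop]:
    this instruction jumps to itself if the answer is 0 and falls off the end otherwise. *)
Lemma halts_iff_outputs_true (f : nat -> nat) (p : list instr) :
  computable (fun l => f (nth 0 l 0)) ->
  exists q, forall x b, outputs p (f x) b -> (halts q x <-> b = true).
Proof.
  intros Hf. destruct (Hf [0] 1) as [c Hc].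
  { intros r [<-|[]]. lia. }
  set (z := S (max_reg c)). set (l1 := compile z 0 c).
  set (off := length l1). set (l2 := map (reloc off (length p)) p).
  set (stop := off + length p).
  exists (l1 ++ l2 ++ [DEC 1 stop]). set (q := l1 ++ l2 ++ [DEC 1 stop]).
  intros x b (k & Hk & Ho).
  assert (Hlen : length q = S stop).
  { unfold q, l2, stop, off. rewrite !length_app, length_map. cbn. lia. }
  assert (Hq : nth_error q stop = Some (DEC 1 stop)).
  { unfold q, stop, off. rewrite nth_error_app2 by lia.
    rewrite nth_error_app2; unfold l2; rewrite length_map; [|lia].
    replace (length l1 + length p - length l1 - length p) with 0 by lia. reflexivity. }
  set (s0 := snd (init_state x)).
  assert (S1 : steps q (0, s0) (off, upd s0 1 (f x))).
  { apply (compile_correct q z c s0 (upd s0 1 (f x)) 0).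
    - apply (Hc s0). intros r Hr. unfold s0. cbn. destruct r; [lia|reflexivity].
    - unfold z. lia.
    - reflexivity.
    - unfold q. apply (code_at_mid [] l1). }
  destruct (reloc_sim q p off (upd s0 1 (f x)) k (init_state (f x))) as (regs & Hregs & S2).
  - apply code_at_mid.
  - intros [|r]; reflexivity.
  - cbn. lia.
  - rewrite Nat.min_r in S2 by exact Hk. cbn [init_state fst] in S2.
    rewrite Nat.add_0_r in S2. specialize (Hregs 0). rewrite Ho in Hregs.
    assert (S3 := steps_trans _ _ _ _ S1 S2). fold stop in S3.
    destruct b; split; auto.
    + intros _. destruct S3 as [n Hn]. exists (S n). unfold init_state. fold s0.
      rewrite run_S. change (0, _) with (0, s0). rewrite Hn. unfold halted.
      cbn [step]. rewrite Hq, Hregs. cbn [fst]. lia.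
    + intros [n Hn]. destruct (steps_halted _ _ _ _ S3 Hn) as [n' Hn'].
      assert (E : run q n' (stop, regs) = (stop, regs)).
      { clear Hn'. induction n' as [|n' IH]; auto. rewrite run_S, IH.
        cbn [step]. now rewrite Hq, Hregs. }
      rewrite E in Hn'. unfold halted in Hn'. cbn [fst] in Hn'. lia.
    + discriminate.
Qed.

(** * Graphs presented by labels *)

Lemma edge_12 G i a b : i = 1 \/ i = 2 ->
  (edge G i a b <-> In (a, b) (if i =? 1 then gs1 G else gs2 G)).
Proof. intros [->| ->]; reflexivity. Qed.

Lemma in_down {B : Type} n (g : nat -> B) base z :
  In z (down n (fun j L => g j :: L) base) <-> In z base \/ exists j, j < n /\ z = g j.
Proof.
  revert base. induction n as [|n IH]; intros base; cbn [down].
  - split; auto. intros [H|(j & H & _)]; auto. lia.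
  - rewrite IH. cbn. split.
    + intros [[<-|H]|(j & H & ->)]; auto; right; [exists n|exists j]; auto.
    + intros [H|(j & H & ->)]; auto. destruct (Nat.eq_dec j n) as [->|Hj]; auto.
      right. exists j. split; auto; lia.
Qed.

Section Labelled.

Variable A : Type.
Variable A_eq_dec : forall l l' : A, {l = l'} + {l <> l'}.
Variable d : A.

Fixpoint index (l : A) (ls : list A) : nat :=
  match ls with
  | [] => 0
  | l' :: ls' => if A_eq_dec l l' then 0 else S (index l ls')
  end.

Lemma index_lt l ls : In l ls -> index l ls < length ls.
Proof.
  induction ls as [|l' ls IH]; cbn; [tauto|]. intros H.
  destruct (A_eq_dec l l'); [lia|]. destruct H as [H|H]; [congruence|].
  apply IH in H. lia.
Qed.

Lemma nth_index l ls : In l ls -> nth (index l ls) ls d = l.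
Proof.
  induction ls as [|l' ls IH]; cbn; [tauto|]. intros H.
  destruct (A_eq_dec l l'); [congruence|]. destruct H as [H|H]; [congruence|]. auto.
Qed.

Lemma index_app_in l ls ls' : In l ls -> index l (ls ++ ls') = index l ls.
Proof.
  induction ls as [|l' ls IH]; cbn; [tauto|]. intros H.
  destruct (A_eq_dec l l'); auto. destruct H as [H|H]; [congruence|]. f_equal; auto.
Qed.

Definition label_pairs (ls : list A) (e : A -> A -> bool) : list (nat * nat) :=
  filter (fun ab => e (nth (fst ab) ls d) (nth (snd ab) ls d))
    (list_prod (seq 0 (length ls)) (seq 0 (length ls))).

Lemma in_label_pairs ls e a b :
  In (a, b) (label_pairs ls e) <->
  (a < length ls /\ b < length ls) /\ e (nth a ls d) (nth b ls d) = true.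
Proof.
  unfold label_pairs. rewrite filter_In, in_prod_iff, !in_seq. cbn. intuition lia.
Qed.

Definition labelling (E : nat -> A -> A -> bool) (valid : A -> Prop) (null root : A)
  (H : graph) (l : nat -> A) : Prop :=
  (forall x, x < gn H -> valid (l x)) /\
  (forall i x y, i = 1 \/ i = 2 -> edge H i x y -> E i (l x) (l y) = true) /\
  (forall x, x < gn H -> (l x = root <-> x = groot H)) /\
  (forall x, x < gn H -> (l x = null <-> x = gnull H)).

(** Several nodes may carry the same label, null and root excepted: edges must be sound for all of
    them, but complete only between the representatives chosen by [code]. This freedom allows
    [labs1] to list labels twice. *)
Record presents (G : graph) (lb : nat -> A) (code : A -> nat)
  (E : nat -> A -> A -> bool) (valid : A -> Prop) (null root : A) : Prop := {
  code_lt : forall l, valid l -> code l < gn G;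
  lb_code : forall l, valid l -> lb (code l) = l;
  lb_valid : forall a, a < gn G -> valid (lb a);
  lb_edge : forall i a b, i = 1 \/ i = 2 -> edge G i a b -> E i (lb a) (lb b) = true;
  code_edge : forall i l l', i = 1 \/ i = 2 -> valid l -> valid l' ->
    E i l l' = true -> edge G i (code l) (code l');
  lb_null : forall a, a < gn G -> (lb a = null <-> a = gnull G);
  lb_root : forall a, a < gn G -> (lb a = root <-> a = groot G);
  bound_null : gnull G < gn G;
  bound_root : groot G < gn G
}.

Lemma hom_iff_labelling G lb code E valid null root H :
  presents G lb code E valid null root -> wf_graph H ->
  (hom_exists H G <-> exists l, labelling E valid null root H l).
Proof.
  intros P (_ & _ & _ & HV & _). split.
  - intros (h & H1 & H2 & H3 & H4). exists (fun x => lb (h x)). repeat split.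
    + intros x Hx. apply (lb_valid _ _ _ _ _ _ _ P). auto.
    + intros i x y Hi He. apply (lb_edge _ _ _ _ _ _ _ P); auto.
    + intros E0. apply H3; auto. apply (lb_root _ _ _ _ _ _ _ P); auto.
    + intros E0. apply (lb_root _ _ _ _ _ _ _ P); auto. apply H3; auto.
    + intros E0. apply H4; auto. apply (lb_null _ _ _ _ _ _ _ P); auto.
    + intros E0. apply (lb_null _ _ _ _ _ _ _ P); auto. apply H4; auto.
  - intros (l & H1 & H2 & H3 & H4). exists (fun x => code (l x)). repeat split.
    + intros x Hx. apply (code_lt _ _ _ _ _ _ _ P). auto.
    + intros i x y Hi He. destruct (HV i x y Hi He).
      apply (code_edge _ _ _ _ _ _ _ P); auto.
    + intros E0. apply H3; auto. rewrite <- (lb_code _ _ _ _ _ _ _ P (l x)), E0 by auto.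
      apply (lb_root _ _ _ _ _ _ _ P); auto. apply (bound_root _ _ _ _ _ _ _ P).
    + intros E0. apply H3 in E0; auto. apply (lb_root _ _ _ _ _ _ _ P).
      * apply (code_lt _ _ _ _ _ _ _ P). auto.
      * now rewrite (lb_code _ _ _ _ _ _ _ P (l x)) by auto.
    + intros E0. apply H4; auto. rewrite <- (lb_code _ _ _ _ _ _ _ P (l x)), E0 by auto.
      apply (lb_null _ _ _ _ _ _ _ P); auto. apply (bound_null _ _ _ _ _ _ _ P).
    + intros E0. apply H4 in E0; auto. apply (lb_null _ _ _ _ _ _ _ P).
      * apply (code_lt _ _ _ _ _ _ _ P). auto.
      * now rewrite (lb_code _ _ _ _ _ _ _ P (l x)) by auto.
Qed.

Lemma wf_presents G lb code E (valid : A -> Prop) null root :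
  presents G lb code E valid null root -> valid null -> null <> root ->
  (forall i l, i = 1 \/ i = 2 -> (E i null l = true <-> l = null)) ->
  (forall i a b, i = 1 \/ i = 2 -> edge G i a b -> a < gn G /\ b < gn G) -> wf_graph G.
Proof.
  intros P Vn Hnr HE HB.
  assert (Bn := bound_null _ _ _ _ _ _ _ P). assert (Br := bound_root _ _ _ _ _ _ _ P).
  assert (Ln := proj2 (lb_null _ _ _ _ _ _ _ P _ Bn) eq_refl).
  assert (Lr := proj2 (lb_root _ _ _ _ _ _ _ P _ Br) eq_refl).
  split; [auto|split; [auto|split; [congruence|split; [auto|]]]].
  intros i x Hi Hx. split.
  - intros He. apply (lb_edge _ _ _ _ _ _ _ P) in He; auto. rewrite Ln in He.
    apply HE in He; auto. now apply (lb_null _ _ _ _ _ _ _ P).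
  - intros ->.
    assert (C : code null = gnull G).
    { apply (lb_null _ _ _ _ _ _ _ P).
      - now apply (code_lt _ _ _ _ _ _ _ P).
      - now apply (lb_code _ _ _ _ _ _ _ P). }
    rewrite <- C. apply (code_edge _ _ _ _ _ _ _ P); auto. now apply HE.
Qed.

End Labelled.

Arguments index {A}.
Arguments label_pairs {A}.
Arguments labelling {A}.
Arguments presents {A}.

(** * The two constraints *)

(* Labels of [G1].  [Main1 i b r] labels the list cell holding register [r] in
   a configuration about to execute instruction [i]; [b] guesses that a [DEC]
   finds 0.  The instruction number [length q] marks an extra initial block.
   [NumJ j] labels the numeral [j] for [1 <= j <= x], [NumBig] the numerals
   beyond [x]; the numeral 0 is null. *)
Inductive lab1 : Type :=
  | Null1
  | Root1
  | NumBig
  | NumJ (j : nat)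
  | Main1 (i : nat) (b : bool) (r : nat).

(* Labels of [G2].  [Val a c] labels a non-null numeral of colour [a] whose
   predecessor has colour [c], null having colour 0.  [Start] is the cell [m]
   whose contents, of colour [c], is claimed to be wrongly updated; [Err inc c d]
   is the cell [d] places before the cell [m + k] to be compared with. *)
Inductive lab2 : Type :=
  | Null2
  | Root2
  | Val (a c : nat)
  | Pre (i : nat) (b : bool) (r : nat)
  | Start (i : nat) (b : bool) (r c : nat)
  | Err (inc : bool) (c d : nat)
  | Junk.

Lemma lab1_eq_dec (l l' : lab1) : {l = l'} + {l <> l'}.
Proof. decide equality; try apply Nat.eq_dec; apply bool_dec. Defined.

Lemma lab2_eq_dec (l l' : lab2) : {l = l'} + {l <> l'}.
Proof. decide equality; try apply Nat.eq_dec; apply bool_dec. Defined.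

Inductive change : Type := Keep | Up | Down.

Section Reduction.

Variable q : list instr.
Variable k : nat.
Hypothesis k_pos : 0 < k.

(** Among the indices of valid labels, only [length q] has no instruction. So the [None] branches
    here and below describe the initial block: register 0 is non-null, the others are null,
    everything is kept, and instruction 0 comes next. *)
Definition effect (i : nat) (b : bool) (r : nat) : change :=
  match nth_error q i with
  | Some (INC r') => if r =? r' then Up else Keep
  | Some (DEC r' _) => if r =? r' then (if b then Keep else Down) else Keep
  | None => Keep
  end.

(* [z] tells whether register [r] holds 0. *)
Definition consistent (i : nat) (b : bool) (r : nat) (z : bool) : bool :=
  match nth_error q i with
  | Some (INC _) => true
  | Some (DEC r' _) => if r =? r' then eqb b z else true
  | None => eqb z (negb (r =? 0))
  end.

Definition next_instr (i : nat) (b : bool) : nat :=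
  match nth_error q i with
  | Some (INC _) => S i
  | Some (DEC _ j) => if b then j else S i
  | None => 0
  end.

(** The guess is constant in a block and free at the start of the next one. The bound
    [i' <? length q] keeps a list from continuing past a halt, and from entering the initial block
    again. *)
Definition next_cell (i : nat) (b : bool) (r i' : nat) (b' : bool) (r' : nat) : bool :=
  if S r <? k then (i' =? i) && eqb b' b && (r' =? S r)
  else (i' =? next_instr i b) && (i' <? length q) && (r' =? 0).

Definition last_cell (i : nat) (b : bool) (r : nat) : bool :=
  (k <=? S r) && (length q <=? next_instr i b).

Definition cells : list (nat * bool * nat) :=
  list_prod (list_prod (seq 0 (S (length q))) [true; false]) (seq 0 k).

Lemma in_cells i b r : In (i, b, r) cells <-> i <= length q /\ r < k.
Proof.
  unfold cells. rewrite !in_prod_iff, !in_seq. cbn. destruct b; intuition lia.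
Qed.

(** The labels [NumJ j] count down to null one by one, so a content labelled [NumJ x] is the numeral
    [x] exactly; this fixes the input. In the initial block a single label,
    [Main1 (length q) false 0], may point to it. The s2-edge from the root to [NumBig] lets a heap
    hang all its numerals, as one chain, from the root. *)
Definition e1 (x : nat) (s : nat) (l l' : lab1) : bool :=
  if s =? 1 then
    match l, l' with
    | Null1, Null1 => true
    | Root1, Main1 i b r => (i =? length q) && negb b && (r =? 0)
    | Main1 i b r, Main1 i' b' r' => next_cell i b r i' b' r'
    | Main1 i b r, Null1 => last_cell i b r
    | NumBig, NumBig => true
    | NumBig, NumJ j => j =? x
    | NumJ j, NumJ j' => j =? S j'
    | NumJ j, Null1 => j =? 1
    | _, _ => false
    end
  else
    match l, l' with
    | Null1, Null1 => true
    | Root1, NumBig => true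
    | Main1 i b r, Null1 => consistent i b r true
    | Main1 i b r, NumBig => consistent i b r false && negb (i =? length q)
    | Main1 i b r, NumJ j =>
        if i =? length q then negb b && (r =? 0) && (j =? x) else consistent i b r false
    | NumBig, Null1 => true
    | NumJ _, Null1 => true
    | _, _ => false
    end.

Definition colour (l : lab2) : nat := match l with Val a _ => a | _ => 0 end.
Definition colour_pred (l : lab2) : nat := match l with Val _ c => c | _ => 0 end.
Definition is_val (l : lab2) : bool :=
  match l with Null2 | Val _ _ => true | _ => false end.
Definition is_null (l : lab2) : bool := match l with Null2 => true | _ => false end.

(** Among the cell labels only [Junk] and [Err] at distance 0 may precede [Null2], so a list that
    ends must exhibit its error first. The stored colour [c] is the one the correct content would
    yield: for [Down] the predecessor is taken on the old side, at [Start]; for [Up] on the new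
    side, at [Err]. *)
Definition e2 (s : nat) (l l' : lab2) : bool :=
  if s =? 1 then
    match l, l' with
    | Null2, Null2 => true
    | Root2, Pre i b r => (i =? length q) && (r =? 0)
    | Root2, Start i b r _ => (i =? length q) && (r =? 0)
    | Pre i b r, Pre i' b' r' => next_cell i b r i' b' r'
    | Pre i b r, Start i' b' r' _ => next_cell i b r i' b' r'
    | Start i b r c, Err inc c' d =>
        eqb inc (match effect i b r with Up => true | _ => false end)
        && (c' =? c) && (S d =? k)
    | Err inc c d, Err inc' c' d' => eqb inc' inc && (c' =? c) && (d =? S d')
    | Err _ _ d, Junk => d =? 0
    | Err _ _ d, Null2 => d =? 0
    | Junk, Junk => true
    | Junk, Null2 => true
    | Val _ c, Val a' _ => a' =? c
    | Val _ c, Null2 => c =? 0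
    | _, _ => false
    end
  else
    match l with
    | Null2 => is_null l'
    | Root2 | Val _ _ | Junk => is_val l'
    | Pre i b r => is_val l' && consistent i b r (is_null l')
    | Start i b r c =>
        is_val l' && consistent i b r (is_null l') &&
        (c =? match effect i b r with Down => colour_pred l' | _ => colour l' end)
    | Err inc c (S d) => is_val l'
    | Err inc c 0 =>
        is_val l' &&
        (if inc then is_null l' || negb (colour_pred l' =? c) else negb (colour l' =? c))
    end.

Definition wide (irb : nat * bool * nat) : bool :=
  let '(i, b, r) := irb in consistent i b r false && negb (i =? length q).

Definition main1 (irb : nat * bool * nat) : lab1 :=
  let '(i, b, r) := irb in Main1 i b r.

Definition wide_labs : list lab1 := map main1 (filter wide cells).

(** The order puts every label with an edge to or from a numeral at a position known without [q]:
    null is 0, the initial cell 2, [NumBig] 3, and the labels that may point to any numeral start at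
    4. The final copy of all cells repeats some labels; [index] picks the first occurrence. *)
Definition labs1 : list lab1 :=
  Null1 :: Root1 :: Main1 (length q) false 0 :: NumBig :: wide_labs ++ map main1 cells.

Definition labs2 : list lab2 :=
  Null2 :: Root2 :: Junk ::
  map (fun ac => Val (fst ac) (snd ac)) (list_prod [1; 2] [0; 1; 2]) ++
  map (fun irb => let '(i, b, r) := irb in Pre i b r) cells ++
  map (fun irbc => let '(i, b, r, c) := irbc in Start i b r c) (list_prod cells [0; 1; 2]) ++
  map (fun icd => let '(inc, c, d) := icd in Err inc c d)
    (list_prod (list_prod [true; false] [0; 1; 2]) (seq 0 k)).

Definition valid2 (l : lab2) : Prop := In l labs2.

Lemma valid2_iff l : valid2 l <->
  match l with
  | Null2 | Root2 | Junk => True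
  | Val a c => 1 <= a <= 2 /\ c <= 2
  | Pre i b r => i <= length q /\ r < k
  | Start i b r c => i <= length q /\ r < k /\ c <= 2
  | Err inc c d => c <= 2 /\ d < k
  end.
Proof.
  unfold valid2, labs2. cbn [In]. rewrite !in_app_iff, !in_map_iff.
  assert (C3 : forall c, In c [0; 1; 2] <-> c <= 2) by (intros c; cbn; lia).
  assert (C2 : forall c, In c [1; 2] <-> 1 <= c <= 2) by (intros c; cbn; lia).
  split.
  - intros [<-|[<-|[<-|[((a & c) & <- & H)|[(((i & b) & r) & <- & H)|
      [((((i & b) & r) & c) & <- & H)|(((i & c) & d) & <- & H)]]]]]]; try exact I.
    + rewrite in_prod_iff, C2, C3 in H. exact H.
    + now apply in_cells in H.
    + rewrite in_prod_iff, in_cells, C3 in H. tauto.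
    + rewrite !in_prod_iff, C3, in_seq in H. intuition lia.
  - destruct l as [| |a c|i b r|i b r c|inc c d|]; intros H; auto; do 3 right.
    + left. exists (a, c). rewrite in_prod_iff, C2, C3. auto.
    + right; left. exists (i, b, r). now rewrite in_cells.
    + right; right; left. exists (i, b, r, c). rewrite in_prod_iff, in_cells, C3. tauto.
    + right; right; right. exists (inc, c, d).
      rewrite !in_prod_iff, C3, in_seq. repeat split; try lia. destruct inc; cbn; auto.
Qed.

Definition G2 : graph :=
  mkGraph (length labs2) (label_pairs Null2 labs2 (e2 1)) (label_pairs Null2 labs2 (e2 2)) 0 1.

Lemma edge_G2 i a b : i = 1 \/ i = 2 ->
  (edge G2 i a b <-> (a < length labs2 /\ b < length labs2) /\
    e2 i (nth a labs2 Null2) (nth b labs2 Null2) = true).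
Proof. intros [->| ->]; apply in_label_pairs. Qed.

Lemma nth_two {A : Type} (d l0 l1 : A) tl :
  l0 <> l1 -> ~ In l0 tl -> ~ In l1 tl -> forall a, a < length (l0 :: l1 :: tl) ->
  (nth a (l0 :: l1 :: tl) d = l0 <-> a = 0) /\ (nth a (l0 :: l1 :: tl) d = l1 <-> a = 1).
Proof.
  intros H H0 H1 [|[|a]] Ha; cbn in *; repeat split; intros E; try congruence; try lia;
    exfalso; [apply H0|apply H1]; rewrite <- E; apply nth_In; lia.
Qed.

Lemma nth_labs2 a : a < length labs2 ->
  (nth a labs2 Null2 = Null2 <-> a = 0) /\ (nth a labs2 Null2 = Root2 <-> a = 1).
Proof.
  apply nth_two; [discriminate| |];
    (intros [H|H]; [discriminate|];
    rewrite !in_app_iff, !in_map_iff in H;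
    destruct H as [((u & v) & H & _)|[(((i & b) & r) & H & _)|
    [((((i & b) & r) & c) & H & _)|(((i & c) & d) & H & _)]]]; discriminate).
Qed.

Lemma presents_G2 :
  presents G2 (fun a => nth a labs2 Null2) (fun l => index lab2_eq_dec l labs2)
    e2 valid2 Null2 Root2.
Proof.
  constructor; cbn [G2 gn gnull groot].
  - intros l. apply index_lt.
  - intros l. apply nth_index.
  - intros a. apply nth_In.
  - intros i a b Hi H. now apply edge_G2 in H.
  - intros i l l' Hi Hl Hl' H. apply edge_G2; auto. split.
    + split; now apply index_lt.
    + now rewrite !nth_index by auto.
  - apply nth_labs2.
  - apply nth_labs2.
  - cbn. lia.
  - cbn. lia.
Qed.

Lemma wf_G2 : wf_graph G2.
Proof.
  apply (wf_presents _ _ _ _ _ _ _ _ presents_G2).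
  - now apply valid2_iff.
  - discriminate.
  - intros i l [->| ->]; destruct l; cbn; intuition congruence.
  - intros i a b Hi H. now apply edge_G2 in H.
Qed.

(** * The graph [G1] as a fixed part followed by a chain of numerals *)

Definition base := length labs1.

Definition nth1 (a : nat) : lab1 :=
  if a <? base then nth a labs1 Null1 else NumJ (a - base + 1).

Definition code1 (l : lab1) : nat :=
  match l with
  | NumJ j => base + j - 1
  | _ => index lab1_eq_dec l labs1
  end.

Definition valid1 (x : nat) (l : lab1) : Prop :=
  match l with
  | Null1 | Root1 | NumBig => True
  | NumJ j => 1 <= j <= x
  | Main1 i b r => i <= length q /\ r < k
  end.

(* The edges into the numeral labels depend on the input [y] only through
   loops, so that they can be computed without knowing [q]. *)
Definition chain1 (B y : nat) (L : list (nat * nat)) : list (nat * nat) :=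
  (3, B + y) :: down y (fun j L => (B + j + 1, B + j) :: L) L.

Definition chain2 (B R y : nat) (L : list (nat * nat)) : list (nat * nat) :=
  (2, B + y) ::
  down (S y) (fun j L => down R (fun l L => (l + 4, B + j) :: L) ((B + j, 0) :: L)) L.

(** The value 0 for the input is a dummy: [e1] consults the input only for edges into numerals, and
    [labs1] has none. The pair [(base, 0)] is the edge from the numeral 1 to null, present for every
    input. *)
Definition base_edges1 : list (nat * nat) := (base, 0) :: label_pairs Null1 labs1 (e1 0 1).
Definition base_edges2 : list (nat * nat) := label_pairs Null1 labs1 (e1 0 2).

(* The machine started on [S y]. *)
Definition G1 (y : nat) : graph :=
  mkGraph (base + S y) (chain1 base y base_edges1)
    (chain2 base (length wide_labs) y base_edges2) 0 1.

Lemma in_wide_labs l : In l wide_labs <->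
  exists i b r, l = Main1 i b r /\ i < length q /\ r < k /\ consistent i b r false = true.
Proof.
  unfold wide_labs. rewrite in_map_iff. split.
  - intros (((i & b) & r) & <- & H). apply filter_In in H as [H W].
    apply in_cells in H. cbn in W. apply andb_true_iff in W as [W1 W2].
    apply negb_true_iff, Nat.eqb_neq in W2. exists i, b, r. repeat split; auto; lia.
  - intros (i & b & r & -> & H1 & H2 & H3). exists (i, b, r). split; auto.
    apply filter_In. split; [apply in_cells; lia|]. cbn. rewrite H3. cbn.
    apply negb_true_iff, Nat.eqb_neq. lia.
Qed.

Lemma in_labs1 l :
  In l labs1 <-> match l with NumJ _ => False | Main1 i _ r => i <= length q /\ r < k
                 | _ => True end.
Proof.
  unfold labs1. cbn [In]. rewrite in_app_iff, in_wide_labs, in_map_iff. split.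
  - intros [<-|[<-|[<-|[<-|[(i & b & r & -> & H)|(((i & b) & r) & <- & H)]]]]]; auto;
      [lia|]. now apply in_cells in H.
  - destruct l as [| | |j|i b r]; intros H; auto; [tauto|].
    do 5 right. exists (i, b, r). now rewrite in_cells.
Qed.

Lemma base_gt : length wide_labs + 4 <= base.
Proof. unfold base, labs1. cbn [length]. rewrite length_app. lia. Qed.

Lemma nth_labs1 a : a < base ->
  (nth a labs1 Null1 = Null1 <-> a = 0) /\ (nth a labs1 Null1 = Root1 <-> a = 1).
Proof.
  assert (M : forall l, In l (wide_labs ++ map main1 cells) -> exists i b r, l = Main1 i b r).
  { intros l. rewrite in_app_iff, in_wide_labs, in_map_iff.
    intros [(i & b & r & -> & _)|(((i & b) & r) & <- & _)]; do 3 eexists; reflexivity. }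
  apply nth_two; [discriminate| |];
    (intros [H|[H|H]]; try discriminate; destruct (M _ H) as (i & b & r & E); discriminate).
Qed.

Lemma nth1_base a : a < base -> nth1 a = nth a labs1 Null1.
Proof. intros H. unfold nth1. apply Nat.ltb_lt in H. now rewrite H. Qed.

Lemma nth1_numeral a : base <= a -> nth1 a = NumJ (a - base + 1).
Proof. intros H. unfold nth1. apply Nat.ltb_ge in H. now rewrite H. Qed.

Lemma nth1_base_plus j : nth1 (base + j) = NumJ (S j).
Proof. rewrite nth1_numeral by lia. f_equal. lia. Qed.

Definition is_numeral (l : lab1) : Prop := match l with NumJ _ => True | _ => False end.

Lemma e1_base x s l l' : ~ is_numeral l' -> e1 x s l l' = e1 0 s l l'.
Proof.
  intros H. unfold e1. destruct l, l'; cbn in H; try tauto; reflexivity.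
Qed.

Lemma base_label a : a < base -> ~ is_numeral (nth a labs1 Null1).
Proof.
  intros H. apply (nth_In labs1 Null1) in H. apply in_labs1 in H.
  destruct (nth a labs1 Null1); auto.
Qed.

Lemma in_chain1 B y L a b : In (a, b) (chain1 B y L) <->
  (a, b) = (3, B + y) \/ In (a, b) L \/ exists j, j < y /\ (a, b) = (B + j + 1, B + j).
Proof.
  unfold chain1. cbn [In]. rewrite in_down.
  split; (intros [H|H]; [left; congruence|right; exact H]).
Qed.

Lemma in_chain2 B R y L a b : In (a, b) (chain2 B R y L) <->
  (a, b) = (2, B + y) \/ In (a, b) L \/
  exists j, j <= y /\ b = B + j /\ 4 <= a < R + 4 \/ j <= y /\ (a, b) = (B + j, 0).
Proof.
  unfold chain2. cbn [In].
  set (f := fun j L => down R (fun l L => (l + 4, B + j) :: L) ((B + j, 0) :: L)).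
  assert (G : forall n L, In (a, b) (down n f L) <-> In (a, b) L \/
    exists j, j < n /\ b = B + j /\ 4 <= a < R + 4 \/ j < n /\ (a, b) = (B + j, 0)).
  { clear L. induction n as [|n IH]; intros L; cbn [down].
    - split; auto. intros [H|(j & H)]; auto. lia.
    - rewrite IH. unfold f at 1. rewrite in_down. cbn [In]. split.
      + intros [[[H|H]|(j & Hj & H)]|(j & Hj)]; auto; right.
        * exists n. right. split; [lia|congruence].
        * exists n. left. injection H as -> ->. lia.
        * exists j. destruct Hj as [Hj|[Hj1 Hj2]]; [left; lia|right; split; auto; lia].
      + intros [H|(j & Hj)]; auto. destruct (Nat.eq_dec j n) as [->|Hn].
        * left. destruct Hj as [(_ & -> & Hj)|[_ Hj]]; [|now left; left].
          right. exists (a - 4). split; [lia|]. f_equal; lia.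
        * right. exists j. destruct Hj as [Hj|[Hj1 Hj2]]; [left; lia|right; split; auto; lia]. }
  rewrite G. split; (intros [H|[H|(j & H)]]; [left; congruence|right; left; exact H|
    right; right; exists j]);
    (destruct H as [H|[H1 H2]]; [left; lia|right; split; auto; lia]).
Qed.

Lemma wide_index a : 4 <= a < length wide_labs + 4 -> In (nth a labs1 Null1) wide_labs.
Proof.
  intros H. unfold labs1. replace a with (S (S (S (S (a - 4))))) by lia. cbn [nth].
  rewrite app_nth1 by lia. apply nth_In. lia.
Qed.

Lemma index_wide l : In l wide_labs -> l <> Main1 (length q) false 0 ->
  4 <= index lab1_eq_dec l labs1 < length wide_labs + 4.
Proof.
  intros H Hn. pose proof (index_lt _ lab1_eq_dec _ _ H).
  pose proof (index_app_in _ lab1_eq_dec l wide_labs (map main1 cells) H) as E.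
  apply in_wide_labs in H as (i & b & r & -> & _).
  assert (E' : index lab1_eq_dec (Main1 i b r) labs1 =
    4 + index lab1_eq_dec (Main1 i b r) (wide_labs ++ map main1 cells)).
  { unfold labs1. generalize (wide_labs ++ map main1 cells). intros L.
    cbn [index]. destruct (lab1_eq_dec _ Null1); [discriminate|].
    destruct (lab1_eq_dec _ Root1); [discriminate|].
    destruct (lab1_eq_dec _ (Main1 (length q) false 0)); [congruence|].
    destruct (lab1_eq_dec _ NumBig); [discriminate|]. reflexivity. }
  lia.
Qed.

Lemma edge_base_edges s a b :
  In (a, b) (label_pairs Null1 labs1 (e1 0 s)) <->
  (a < base /\ b < base) /\ forall x, e1 x s (nth1 a) (nth1 b) = true.
Proof.
  rewrite in_label_pairs. fold base. split; intros [[Ha Hb] H]; split; auto.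
  - intros x. rewrite !nth1_base, e1_base; auto. now apply base_label.
  - rewrite !nth1_base in H; auto.
Qed.

Lemma presents_G1 y : presents (G1 y) nth1 code1 (e1 (S y)) (valid1 (S y)) Null1 Root1.
Proof.
  assert (HB := base_gt).
  assert (C : forall l, valid1 (S y) l -> ~ is_numeral l -> In l labs1).
  { intros l H1 H2. apply in_labs1. destruct l; cbn in *; auto. }
  assert (CB : forall l, valid1 (S y) l -> ~ is_numeral l ->
    code1 l < base /\ nth1 (code1 l) = l).
  { intros l H1 H2. specialize (C l H1 H2).
    replace (code1 l) with (index lab1_eq_dec l labs1) by (destruct l; cbn in *; tauto).
    assert (H := index_lt _ lab1_eq_dec _ _ C). split; [exact H|].
    rewrite nth1_base by exact H. now apply nth_index. }
  assert (CN : forall j, valid1 (S y) (NumJ j) -> code1 (NumJ j) = base + j - 1 /\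
    1 <= j <= S y).
  { intros j H. split; [reflexivity|exact H]. }
  constructor; cbn [G1 gn gnull groot]; try lia.
  - intros l H. destruct l as [| | |j|i b r];
      try (match goal with |- code1 ?l < _ => destruct (CB l H) as [H1 _]; [tauto|]; lia end).
    destruct (CN _ H). lia.
  - intros l H. destruct l as [| | |j|i b r];
      try (match goal with |- nth1 (code1 ?l) = _ => now apply (CB l H) end).
    destruct (CN _ H) as [E Hj]. rewrite E.
    replace (base + j - 1) with (base + (j - 1)) by lia. rewrite nth1_base_plus.
    f_equal. lia.
  - intros a Ha. destruct (Nat.lt_ge_cases a base) as [H|H].
    + rewrite nth1_base by auto. apply (nth_In labs1 Null1) in H. apply in_labs1 in H.
      destruct (nth a labs1 Null1); cbn; tauto.
    + rewrite nth1_numeral by auto. cbn [valid1]. lia.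
  - intros i a b [->| ->] H; cbn [edge G1 gs1 gs2] in H.
    + apply in_chain1 in H as [H|[[H|H]|(j & Hj & H)]].
      * apply pair_equal_spec in H as [-> ->]. rewrite nth1_base_plus, (nth1_base 3) by lia. cbn.
        apply Nat.eqb_refl.
      * apply pair_equal_spec in H as [<- <-]. replace (nth1 base) with (NumJ 1) by
          (pose proof (nth1_base_plus 0) as E; rewrite Nat.add_0_r in E; congruence).
        rewrite (nth1_base 0) by lia. reflexivity.
      * now apply edge_base_edges in H.
      * apply pair_equal_spec in H as [-> ->]. rewrite <- Nat.add_assoc, !nth1_base_plus. cbn.
        apply Nat.eqb_eq. lia.
    + apply in_chain2 in H as [H|[H|(j & [(Hj & -> & H)|[Hj H]])]].
      * apply pair_equal_spec in H as [-> ->]. rewrite nth1_base_plus, (nth1_base 2) by lia. cbn.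
        now rewrite !Nat.eqb_refl.
      * now apply edge_base_edges in H.
      * rewrite nth1_base_plus, (nth1_base a) by lia. apply wide_index in H.
        apply in_wide_labs in H as (i & b & r & -> & H1 & _ & H2). cbn.
        destruct (Nat.eqb_spec i (length q)); auto; lia.
      * apply pair_equal_spec in H as [-> ->].
        rewrite nth1_base_plus, (nth1_base 0) by lia. reflexivity.
  - intros i l l' Hi V V' H.
    (* Edges avoiding the numerals lie in the fixed part. After this, five kinds of edges remain,
       each touching a numeral and each supplied by the chains or by the pair [(base, 0)]. *)
    assert (Hbase : ~ is_numeral l -> ~ is_numeral l' -> edge (G1 y) i (code1 l) (code1 l')).
    { intros N N'. destruct (CB l V N) as [A1 A2]. destruct (CB l' V' N') as [B1 B2].
      assert (HE : In (code1 l, code1 l') (label_pairs Null1 labs1 (e1 0 i))).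
      { apply edge_base_edges. split; auto. intros x. rewrite A2, B2.
        rewrite e1_base by auto. now rewrite e1_base in H by auto. }
      destruct Hi as [->| ->].
      - apply in_chain1. right. left. now right.
      - apply in_chain2. now right; left. }
    assert (Num3 : code1 NumBig = 3) by reflexivity.
    assert (Null0 : code1 Null1 = 0) by reflexivity.
    assert (Init2 : code1 (Main1 (length q) false 0) = 2).
    { unfold code1, labs1. cbn [index]. destruct (lab1_eq_dec _ Null1); [discriminate|].
      destruct (lab1_eq_dec _ Root1); [discriminate|].
      destruct (lab1_eq_dec _ _); [reflexivity|congruence]. }
    destruct l as [| | |j|u b r], l' as [| | |j'|u' b' r'];
      try (apply Hbase; cbn; tauto);
      destruct Hi as [->| ->]; cbn in H; try discriminate.
    + apply Nat.eqb_eq in H. subst j'. apply in_chain1. left. rewrite Num3.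
      f_equal. cbn. lia.
    + apply Nat.eqb_eq in H. subst j. apply in_chain1. right. left. left.
      rewrite Null0. cbn [code1]. f_equal. lia.
    + apply in_chain2. right. right. exists (j - 1). right. destruct (CN _ V) as [-> Hj].
      split; [lia|]. rewrite Null0. f_equal. lia.
    + apply Nat.eqb_eq in H. subst j. apply in_chain1. right. right.
      destruct (CN _ V) as [-> Hj]. destruct (CN _ V') as [-> Hj'].
      exists (j' - 1). split; [lia|]. f_equal; lia.
    + apply in_chain2. destruct (CN _ V') as [-> Hj'].
      destruct (Nat.eqb_spec u (length q)) as [->|Hu].
      * apply andb_true_iff in H as [H H3]. apply andb_true_iff in H as [H1 H2].
        apply Nat.eqb_eq in H2, H3. destruct b; [discriminate|]. subst r j'.
        left. rewrite Init2. f_equal. lia.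
      * right. right. exists (j' - 1). left. split; [lia|]. split; [lia|].
        apply index_wide; [|congruence]. apply in_wide_labs. exists u, b, r.
        destruct V. repeat split; auto; lia.
  - intros a Ha. destruct (Nat.lt_ge_cases a base) as [H|H].
    + rewrite nth1_base by auto. now apply nth_labs1.
    + rewrite nth1_numeral by auto. split; [discriminate|lia].
  - intros a Ha. destruct (Nat.lt_ge_cases a base) as [H|H].
    + rewrite nth1_base by auto. now apply nth_labs1.
    + rewrite nth1_numeral by auto. split; [discriminate|lia].
Qed.

Lemma wf_G1 y : wf_graph (G1 y).
Proof.
  assert (HB := base_gt).
  apply (wf_presents _ _ _ _ _ _ _ _ (presents_G1 y)).
  - exact I.
  - discriminate.
  - intros i l [->| ->]; destruct l; cbn; intuition congruence.
  - intros i a b [->| ->] H; cbn [edge G1 gs1 gs2 gn] in *.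
    + apply in_chain1 in H as [H|[[H|H]|(j & Hj & H)]]; try (apply pair_equal_spec in H; lia).
      apply edge_base_edges in H. lia.
    + apply in_chain2 in H as [H|[H|(j & [(Hj & -> & H)|[Hj H]])]];
        try (apply pair_equal_spec in H; lia); try lia.
      apply edge_base_edges in H. lia.
Qed.

(** * Configurations and the local conditions they satisfy *)

Hypothesis q_regs : forall i ins, nth_error q i = Some ins ->
  match ins with INC r | DEC r _ => r < k end.

(** Time is shifted by one to make room for the initial block. Its program counter [length q] looks
    like that of a halted state, whence the recurring alternative
    [t = 0 \/ fst (cfg x t) < length q]. *)
Definition cfg (x t : nat) : state :=
  match t with
  | 0 => (length q, snd (init_state x))
  | S t => run q t (init_state x)
  end.

Definition update (c : change) (v : nat) : nat :=
  match c with Keep => v | Up => S v | Down => pred v end.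

Definition guess (s : state) : bool :=
  match nth_error q (fst s) with Some (DEC r _) => snd s r =? 0 | _ => false end.

Lemma cfg_update x t b r :
  consistent (fst (cfg x t)) b r (snd (cfg x t) r =? 0) = true ->
  snd (cfg x (S t)) r = update (effect (fst (cfg x t)) b r) (snd (cfg x t) r).
Proof.
  unfold consistent, effect. destruct t as [|t]; cbn [cfg].
  - cbn [fst]. rewrite (proj2 (nth_error_None q (length q)) (le_n _)). reflexivity.
  - rewrite run_S. destruct (run q t (init_state x)) as [pc w]. cbn [step fst snd].
    destruct (nth_error q pc) as [[r'|r' j]|]; auto; intros H.
    + cbn. unfold upd. destruct (Nat.eqb_spec r r') as [->|]; reflexivity.
    + destruct (Nat.eqb_spec r r') as [->|Hr].
      * apply eqb_prop in H. subst b. destruct (w r') as [|v] eqn:E; cbn; auto.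
        unfold upd. now rewrite Nat.eqb_refl.
      * destruct (w r') as [|v]; cbn; auto. unfold upd.
        apply Nat.eqb_neq in Hr. now rewrite Hr.
Qed.

(** By [q_regs] the tested register has a cell in the block, and consistency at that cell forces the
    guess to be right. *)
Lemma cfg_next x t b :
  t = 0 \/ fst (cfg x t) < length q ->
  (forall r, r < k -> consistent (fst (cfg x t)) b r (snd (cfg x t) r =? 0) = true) ->
  fst (cfg x (S t)) = next_instr (fst (cfg x t)) b.
Proof.
  unfold consistent, next_instr. destruct t as [|t]; cbn [cfg].
  - intros _ _. cbn [fst].
    now rewrite (proj2 (nth_error_None q (length q)) (le_n _)).
  - intros [|H]; [lia|]. rewrite run_S. destruct (run q t (init_state x)) as [pc w].
    cbn [step fst snd] in *. destruct (nth_error q pc) as [[r'|r' j]|] eqn:E; auto; intros HC.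
    + specialize (HC r' (q_regs _ _ E)). rewrite Nat.eqb_refl in HC.
      apply eqb_prop in HC. subst b. destruct (w r'); reflexivity.
    + apply nth_error_None in E. lia.
Qed.

(** The input has the form [S y] because the initial block requires a non-null content in register
    0. *)
Lemma guess_consistent y t r :
  t = 0 \/ fst (cfg (S y) t) < length q ->
  consistent (fst (cfg (S y) t)) (guess (cfg (S y) t)) r (snd (cfg (S y) t) r =? 0) = true.
Proof.
  unfold consistent, guess. destruct t as [|t]; cbn [cfg].
  - intros _. cbn [fst]. rewrite (proj2 (nth_error_None q (length q)) (le_n _)).
    cbn. destruct r; reflexivity.
  - intros [|H]; [lia|]. destruct (run q t (init_state (S y))) as [pc w]. cbn [fst snd] in *.
    destruct (nth_error q pc) as [[r'|r' j]|] eqn:E; auto.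
    + destruct (Nat.eqb_spec r r') as [->|]; auto. apply eqb_reflx.
    + apply nth_error_None in E. lia.
Qed.

Lemma next_cell_true i b r i' b' r' :
  next_cell i b r i' b' r' = true <->
  (S r < k /\ i' = i /\ b' = b /\ r' = S r) \/
  (k <= S r /\ i' = next_instr i b /\ i' < length q /\ r' = 0).
Proof.
  unfold next_cell. destruct (Nat.ltb_spec (S r) k); rewrite !andb_true_iff.
  - rewrite !Nat.eqb_eq, eqb_true_iff. intuition lia.
  - rewrite !Nat.eqb_eq, Nat.ltb_lt. intuition lia.
Qed.

Lemma last_cell_true i b r :
  last_cell i b r = true <-> k <= S r /\ length q <= next_instr i b.
Proof. unfold last_cell. now rewrite andb_true_iff, !Nat.leb_le. Qed.

(** * If the machine runs forever, the implication holds *)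

Definition lookup (l : list (nat * nat)) (x : nat) : nat :=
  match find (fun p => fst p =? x) l with Some p => snd p | None => 0 end.

Lemma in_lookup l x y : In (x, y) l -> In (x, lookup l x) l.
Proof.
  intros H. unfold lookup. destruct (find (fun p => fst p =? x) l) as [[u v]|] eqn:E.
  - apply find_some in E as [E1 E2]. apply Nat.eqb_eq in E2. cbn in *. now subst u.
  - apply find_none with (x := (x, y)) in E; auto. cbn in E.
    now rewrite Nat.eqb_refl in E.
Qed.

Section Sound.

Variables (y : nat) (H : graph) (l : nat -> lab1).
Hypothesis heap_H : is_heap H.
Hypothesis lab_H : labelling (e1 (S y)) (valid1 (S y)) Null1 Root1 H l.

Definition suc (i x : nat) : nat := lookup (if i =? 1 then gs1 H else gs2 H) x.

Lemma edge_suc i x : i = 1 \/ i = 2 -> x < gn H -> edge H i x (suc i x).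
Proof.
  intros Hi Hx. destruct heap_H as (_ & HT & _).
  destruct (HT i x Hi Hx) as (z & Hz & _). rewrite edge_12 in * by auto.
  now apply in_lookup in Hz.
Qed.

Lemma suc_edge i x z : i = 1 \/ i = 2 -> x < gn H -> edge H i x z -> z = suc i x.
Proof.
  intros Hi Hx Hz. destruct heap_H as (_ & HT & _).
  destruct (HT i x Hi Hx) as (w & _ & Hw). rewrite (Hw z Hz). symmetry. apply Hw.
  now apply edge_suc.
Qed.

Lemma suc_lt i x : i = 1 \/ i = 2 -> x < gn H -> suc i x < gn H.
Proof.
  intros Hi Hx. destruct heap_H as ((_ & _ & _ & HB & _) & _).
  now apply (HB i x (suc i x) Hi), edge_suc.
Qed.

Notation s1 := (suc 1).
Notation s2 := (suc 2).
Notation null := (gnull H).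
Notation root := (groot H).

Lemma null_lt : null < gn H.
Proof. apply heap_H. Qed.

Lemma root_lt : root < gn H.
Proof. apply heap_H. Qed.

Lemma s1_lt x : x < gn H -> s1 x < gn H.
Proof. apply suc_lt. auto. Qed.

Lemma s2_lt x : x < gn H -> s2 x < gn H.
Proof. apply suc_lt. auto. Qed.

Lemma suc_null i : i = 1 \/ i = 2 -> suc i null = null.
Proof.
  intros Hi. destruct heap_H as ((_ & _ & _ & _ & HN) & _).
  apply (HN i (suc i null) Hi).
  - apply suc_lt, null_lt. auto.
  - apply edge_suc, null_lt. auto.
Qed.

Lemma lab_suc i x : i = 1 \/ i = 2 -> x < gn H -> e1 (S y) i (l x) (l (suc i x)) = true.
Proof.
  intros Hi Hx. apply (proj1 (proj2 lab_H)); auto. now apply edge_suc.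
Qed.

Lemma lab_null x : x < gn H -> (l x = Null1 <-> x = null).
Proof. apply lab_H. Qed.

Lemma lab_root x : x < gn H -> (l x = Root1 <-> x = root).
Proof. apply lab_H. Qed.

Lemma lab_valid x : x < gn H -> valid1 (S y) (l x).
Proof. apply lab_H. Qed.

Definition is_num (x : nat) : Prop :=
  match l x with NumBig | NumJ _ => True | _ => False end.

Lemma cell_s1 x i b r : x < gn H -> l x = Main1 i b r ->
  (s1 x = null /\ k <= S r /\ length q <= next_instr i b) \/
  (exists i' b' r', l (s1 x) = Main1 i' b' r' /\ next_cell i b r i' b' r' = true).
Proof.
  intros Hx E. pose proof (lab_suc 1 x (or_introl eq_refl) Hx) as HE. rewrite E in HE.
  pose proof (s1_lt x Hx). destruct (l (s1 x)) eqn:E'; cbn in HE; try discriminate.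
  - left. split; [now apply lab_null|]. now apply last_cell_true.
  - right. eauto 6.
Qed.

Lemma cell_s2 x i b r : x < gn H -> l x = Main1 i b r ->
  (s2 x = null \/ is_num (s2 x)) /\ consistent i b r (s2 x =? null) = true.
Proof.
  intros Hx E. pose proof (lab_suc 2 x (or_intror eq_refl) Hx) as HE. rewrite E in HE.
  assert (Hs := s2_lt x Hx). unfold is_num.
  destruct (Nat.eqb_spec (s2 x) null) as [En|En].
  - split; auto. rewrite En in HE. now rewrite (proj2 (lab_null null null_lt) eq_refl) in HE.
  - destruct (l (s2 x)) as [| | |j|] eqn:E'; cbn in HE; try discriminate.
    + now apply lab_null in E'.
    + apply andb_true_iff in HE. tauto.
    + split; auto. destruct (Nat.eqb_spec i (length q)) as [->|]; auto.
      apply andb_true_iff in HE as [HE _]. apply andb_true_iff in HE as [_ HE].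
      apply Nat.eqb_eq in HE. subst r. unfold consistent.
      now rewrite (proj2 (nth_error_None q (length q)) (le_n _)).
Qed.

Lemma num_s1 x : x < gn H -> is_num x -> s1 x = null \/ is_num (s1 x).
Proof.
  unfold is_num. intros Hx E. pose proof (lab_suc 1 x (or_introl eq_refl) Hx) as HE.
  pose proof (s1_lt x Hx).
  destruct (l x); try tauto; destruct (l (s1 x)) eqn:E'; cbn in HE; try discriminate; auto;
    left; now apply lab_null.
Qed.

Lemma num_s2 x : x < gn H -> is_num x -> s2 x = null.
Proof.
  unfold is_num. intros Hx E. pose proof (lab_suc 2 x (or_intror eq_refl) Hx) as HE.
  pose proof (s2_lt x Hx).
  destruct (l x); try tauto; destruct (l (s2 x)) eqn:E'; cbn in HE; try discriminate; auto;
    now apply lab_null.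
Qed.

Lemma root_s1 : l (s1 root) = Main1 (length q) false 0.
Proof.
  pose proof (lab_suc 1 root (or_introl eq_refl) root_lt) as HE.
  rewrite (proj2 (lab_root root root_lt) eq_refl) in HE.
  destruct (l (s1 root)) as [| | | |i b r]; cbn in HE; try discriminate.
  rewrite !andb_true_iff, negb_true_iff, !Nat.eqb_eq in HE.
  destruct HE as [[-> ->] ->]. reflexivity.
Qed.

Lemma root_s2 : is_num (s2 root).
Proof.
  pose proof (lab_suc 2 root (or_intror eq_refl) root_lt) as HE.
  rewrite (proj2 (lab_root root root_lt) eq_refl) in HE. unfold is_num.
  destruct (l (s2 root)); cbn in HE; try discriminate; exact I.
Qed.

Definition pos (m : nat) : nat := Nat.iter m s1 (s1 root).

Lemma pos_S m : pos (S m) = s1 (pos m).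
Proof. reflexivity. Qed.

Lemma pos_add m j : pos (j + m) = Nat.iter j s1 (pos m).
Proof. unfold pos. apply Nat.iter_add. Qed.

Lemma pos_lt m : pos m < gn H.
Proof. induction m; [apply s1_lt, root_lt|]. rewrite pos_S. now apply s1_lt. Qed.

Lemma pos_null m m' : m <= m' -> pos m = null -> pos m' = null.
Proof.
  induction 1 as [|m' Hm IH]; auto. intros E. rewrite pos_S, IH by auto.
  apply suc_null. auto.
Qed.

Lemma pos_cell m : pos m = null \/ exists i b r, l (pos m) = Main1 i b r.
Proof.
  induction m as [|m IH].
  - right. exists (length q), false, 0. apply root_s1.
  - rewrite pos_S. destruct IH as [E|(i & b & r & E)].
    + left. rewrite E. apply suc_null. auto.
    + apply cell_s1 in E; [|apply pos_lt].
      destruct E as [E|(i' & b' & r' & E & _)]; [left; tauto|right; eauto].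
Qed.

(** Reachability from the root is used here. The s2-pointers of the root and of the cells, as well
    as both pointers of numerals, lead only to numerals and null, so a cell can be reached only
    along the list. *)
Lemma cell_pos x i b r : x < gn H -> l x = Main1 i b r -> exists m, x = pos m.
Proof.
  intros Hx E.
  assert (R : reach H x).
  { apply heap_H; auto. intros ->.
    now rewrite (proj2 (lab_null null null_lt) eq_refl) in E. }
  assert (G : x < gn H /\ (x = root \/ x = null \/ is_num x \/ exists m, x = pos m)).
  { clear Hx E. induction R as [|j x z Hj R [Hx IH] HE].
    - split; [apply root_lt|auto].
    - apply suc_edge in HE; auto. subst z. split; [now apply suc_lt|].
      destruct IH as [->|[->|[IH|[m ->]]]].
      + destruct Hj as [->| ->].
        * do 3 right. now exists 0.
        * right; right; left. apply root_s2.
      + right; left. now apply suc_null.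
      + destruct Hj as [->| ->].
        * destruct (num_s1 x Hx IH); auto.
        * right; left. now apply num_s2.
      + destruct Hj as [->| ->].
        * do 3 right. now exists (S m).
        * destruct (pos_cell m) as [E|(i' & b' & r' & E)].
          -- rewrite E. right; left. apply suc_null. auto.
          -- apply cell_s2 in E; auto. destruct E as [[E|E] _]; auto. }
  destruct G as [_ [->|[->|[G|G]]]]; auto.
  - now rewrite (proj2 (lab_root root root_lt) eq_refl) in E.
  - now rewrite (proj2 (lab_null null null_lt) eq_refl) in E.
  - unfold is_num in G. now rewrite E in G.
Qed.

Section Colour.

Variable o : nat -> nat.
Hypothesis o_null : forall x, o x = 0 <-> x = null.
Hypothesis o_le : forall x, o x <= 2.

Definition val_label (v : nat) : lab2 := if v =? null then Null2 else Val (o v) (o (s1 v)).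

Lemma colour_val v : colour (val_label v) = o v.
Proof.
  unfold val_label. destruct (Nat.eqb_spec v null) as [->|]; auto.
  symmetry. now apply o_null.
Qed.

Lemma colour_pred_val v : colour_pred (val_label v) = o (s1 v).
Proof.
  unfold val_label. destruct (Nat.eqb_spec v null) as [->|]; auto.
  symmetry. rewrite suc_null by auto. now apply o_null.
Qed.

Lemma is_val_val v : is_val (val_label v) = true.
Proof. unfold val_label. now destruct (v =? null). Qed.

Lemma is_null_val v : is_null (val_label v) = (v =? null).
Proof. unfold val_label. now destruct (v =? null). Qed.

Definition is_cell_label (c : lab2) : Prop :=
  match c with Null2 | Root2 | Val _ _ => False | _ => True end.

(** Once the numerals are coloured, the labels of null, root and numerals are dictated; only the
    labels [phi] of the cells remain to be chosen and checked. *)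
Lemma extend_labelling (phi : nat -> lab2) :
  (forall x i b r, x < gn H -> l x = Main1 i b r ->
     is_cell_label (phi x) /\ valid2 (phi x) /\
     e2 2 (phi x) (val_label (s2 x)) = true /\
     (s1 x = null -> e2 1 (phi x) Null2 = true) /\
     (s1 x <> null -> e2 1 (phi x) (phi (s1 x)) = true)) ->
  e2 1 Root2 (phi (s1 root)) = true ->
  exists l2, labelling e2 valid2 Null2 Root2 H l2.
Proof.
  intros HC HR.
  set (l2 := fun x => match l x with
    | Null1 => Null2 | Root1 => Root2 | Main1 _ _ _ => phi x
    | _ => val_label x end).
  assert (Lnum : forall x, x < gn H -> x = null \/ is_num x -> l2 x = val_label x).
  { unfold l2, is_num, val_label. intros x Hx [->|E].
    - rewrite (proj2 (lab_null null null_lt) eq_refl). now rewrite Nat.eqb_refl.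
    - destruct (l x); tauto. }
  assert (Lnull : l2 null = Null2).
  { unfold l2. now rewrite (proj2 (lab_null null null_lt) eq_refl). }
  assert (Nnull : forall x, x < gn H -> is_num x -> x <> null).
  { intros x Hx E ->. unfold is_num in E.
    now rewrite (proj2 (lab_null null null_lt) eq_refl) in E. }
  exists l2. split; [|split; [|split]].
  - intros x Hx. unfold l2, val_label.
    destruct (l x) eqn:E; try (apply valid2_iff; exact I);
      try (now apply (HC x _ _ _ Hx E)).
    + destruct (Nat.eqb_spec x null) as [|Hn]; apply valid2_iff; auto.
      rewrite <- o_null in Hn. pose proof (o_le x). pose proof (o_le (s1 x)). lia.
    + destruct (Nat.eqb_spec x null) as [|Hn]; apply valid2_iff; auto.
      rewrite <- o_null in Hn. pose proof (o_le x). pose proof (o_le (s1 x)). lia.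
  - intros i x z Hi He.
    assert (Hx : x < gn H) by (apply heap_H in He; tauto).
    apply suc_edge in He; auto. subst z.
    assert (Hsx := suc_lt i x Hi Hx).
    destruct (l x) as [| | |j|u b r] eqn:E.
    + apply lab_null in E; auto. subst x. rewrite suc_null, Lnull by auto.
      now destruct Hi as [->| ->].
    + apply lab_root in E; auto. subst x. replace (l2 root) with Root2
        by (unfold l2; now rewrite (proj2 (lab_root root root_lt) eq_refl)).
      destruct Hi as [->| ->].
      * unfold l2. rewrite root_s1. exact HR.
      * rewrite Lnum; auto using root_s2. apply is_val_val.
    + assert (Nx : is_num x) by (unfold is_num; now rewrite E).
      assert (Ne := Nnull x Hx Nx).
      rewrite (Lnum x Hx) by auto. unfold val_label at 1.
      destruct (Nat.eqb_spec x null); [tauto|]. destruct Hi as [->| ->].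
      * destruct (num_s1 x Hx Nx) as [E1|E1].
        -- rewrite E1, Lnull. cbn. apply Nat.eqb_eq. now apply o_null.
        -- rewrite Lnum by auto. unfold val_label.
           destruct (Nat.eqb_spec (s1 x) null) as [E0|_]; [now apply Nnull in E0|].
           cbn. apply Nat.eqb_refl.
      * rewrite num_s2, Lnull; auto.
    + assert (Nx : is_num x) by (unfold is_num; now rewrite E).
      assert (Ne := Nnull x Hx Nx).
      rewrite (Lnum x Hx) by auto. unfold val_label at 1.
      destruct (Nat.eqb_spec x null); [tauto|]. destruct Hi as [->| ->].
      * destruct (num_s1 x Hx Nx) as [E1|E1].
        -- rewrite E1, Lnull. cbn. apply Nat.eqb_eq. now apply o_null.
        -- rewrite Lnum by auto. unfold val_label.
           destruct (Nat.eqb_spec (s1 x) null) as [E0|_]; [now apply Nnull in E0|].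
           cbn. apply Nat.eqb_refl.
      * rewrite num_s2, Lnull; auto.
    + destruct (HC x u b r Hx E) as (_ & _ & H2 & H3 & H4).
      replace (l2 x) with (phi x) by (unfold l2; now rewrite E).
      destruct Hi as [->| ->].
      * destruct (cell_s1 x u b r Hx E) as [[E1 _]|(i' & b' & r' & E1 & _)].
        -- rewrite E1, Lnull. auto.
        -- unfold l2. rewrite E1. apply H4. intros E0. rewrite E0 in E1.
           now rewrite (proj2 (lab_null null null_lt) eq_refl) in E1.
      * destruct (cell_s2 x u b r Hx E) as [E1 _]. now rewrite Lnum.
  - intros x Hx. rewrite <- lab_root by auto. unfold l2, val_label.
    destruct (l x) eqn:E; try (split; congruence);
      try (destruct (x =? null); split; congruence).
    destruct (HC x _ _ _ Hx E) as [HD _]. split; [|discriminate]. intros E'.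
    now rewrite E' in HD.
  - intros x Hx. rewrite <- lab_null by auto. unfold l2, val_label.
    destruct (l x) eqn:E; try (split; congruence).
    + destruct (Nat.eqb_spec x null) as [En|]; [|split; discriminate].
      apply lab_null in En; auto. congruence.
    + destruct (Nat.eqb_spec x null) as [En|]; [|split; discriminate].
      apply lab_null in En; auto. congruence.
    + destruct (HC x _ _ _ Hx E) as [HD _]. split; [|discriminate]. intros E'.
      now rewrite E' in HD.
Qed.

End Colour.

Hypothesis never_halts : ~ halts q (S y).

Lemma cfg_running t : t = 0 \/ fst (cfg (S y) t) < length q.
Proof.
  destruct t as [|t]; auto. right. destruct (Nat.lt_ge_cases (fst (cfg (S y) (S t))) (length q))
    as [|Hge]; auto. destruct never_halts. exists t. exact Hge.
Qed.

Fixpoint is_numeral_of (v j : nat) : Prop :=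
  match j with
  | 0 => v = null
  | S j => v <> null /\ is_numeral_of (s1 v) j
  end.

(** [NumJ] labels decrease by one along s1 and reach null from 1 only, so they exclude cycles, in
    contrast to [NumBig]. *)
Lemma numeral_label j v : v < gn H -> l v = NumJ j -> is_numeral_of v j.
Proof.
  revert v. induction j as [|j IH]; intros v Hv E.
  - pose proof (lab_valid v Hv) as V. rewrite E in V. cbn in V. lia.
  - split.
    + intros ->. now rewrite (proj2 (lab_null null null_lt) eq_refl) in E.
    + pose proof (lab_suc 1 v (or_introl eq_refl) Hv) as HE. rewrite E in HE.
      pose proof (s1_lt v Hv).
      destruct (l (s1 v)) as [| | |j'|] eqn:E'; cbn in HE; try discriminate.
      * apply Nat.eqb_eq in HE. subst j. now apply lab_null.
      * apply Nat.eqb_eq in HE. subst j'. now apply IH.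
Qed.

Lemma numeral_zero v j : is_numeral_of v j -> (v =? null) = (j =? 0).
Proof.
  destruct j as [|j]; cbn.
  - intros ->. apply Nat.eqb_refl.
  - intros [Hn _]. now apply Nat.eqb_neq.
Qed.

Lemma numeral_pred v j : is_numeral_of v j -> is_numeral_of (s1 v) (pred j).
Proof.
  destruct j as [|j]; cbn; [|tauto]. intros ->. apply suc_null. auto.
Qed.

(** For [Up], the condition on s1 alone would let 0 pass for the successor of 0, null being its own
    s1-successor. *)
Definition correct_update (m : nat) : Prop :=
  forall i b r, l (pos m) = Main1 i b r ->
  match effect i b r with
  | Keep => s2 (pos (m + k)) = s2 (pos m)
  | Up => s2 (pos (m + k)) <> null /\ s1 (s2 (pos (m + k))) = s2 (pos m)
  | Down => s2 (pos (m + k)) = s1 (s2 (pos m))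
  end.

Lemma block_labels m i b : l (pos m) = Main1 i b 0 ->
  forall r, r < k -> l (pos (m + r)) = Main1 i b r.
Proof.
  intros E. induction r as [|r IH]; intros Hr; [now rewrite Nat.add_0_r|].
  rewrite Nat.add_succ_r, pos_S. specialize (IH ltac:(lia)).
  apply cell_s1 in IH; [|apply pos_lt].
  destruct IH as [(_ & HL & _)|(i' & b' & r' & -> & HN)]; [lia|].
  apply next_cell_true in HN as [(_ & -> & -> & ->)|HN]; auto; lia.
Qed.

(** Induction over the blocks. Consistency makes the guess right, so the next block carries the
    right instruction; correct updates transport the contents. Since the machine never halts,
    [last_cell] is never allowed and there always is a next block. *)
Lemma simulation :
  (forall m, pos (m + k) <> null -> correct_update m) ->
  forall t, exists b, forall r, r < k ->
    l (pos (t * k + r)) = Main1 (fst (cfg (S y) t)) b r /\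
    is_numeral_of (s2 (pos (t * k + r))) (snd (cfg (S y) t) r).
Proof.
  intros HU. induction t as [|t (b & IH)].
  - exists false. pose proof (block_labels 0 _ _ root_s1) as HB. cbn [Nat.add Nat.mul] in *.
    intros r Hr. specialize (HB r Hr). split; [exact HB|].
    pose proof (lab_suc 2 (pos r) (or_intror eq_refl) (pos_lt r)) as HE. rewrite HB in HE.
    pose proof (s2_lt _ (pos_lt r)) as Hlt. cbn [cfg snd init_state].
    destruct (l (s2 (pos r))) as [| | |j|] eqn:E; cbn in HE; try discriminate.
    + unfold consistent in HE.
      rewrite (proj2 (nth_error_None q (length q)) (le_n _)) in HE. cbn in HE.
      destruct (r =? 0); [discriminate|]. now apply lab_null.
    + rewrite Nat.eqb_refl, andb_false_r in HE. discriminate.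
    + rewrite Nat.eqb_refl in HE. apply andb_true_iff in HE as [H1 H2]. cbn in H1.
      rewrite H1. apply Nat.eqb_eq in H2. subst j. now apply numeral_label.
  - set (w := snd (cfg (S y) t)) in *. set (i := fst (cfg (S y) t)) in *.
    assert (HC : forall r, r < k -> consistent i b r (w r =? 0) = true).
    { intros r Hr. destruct (IH r Hr) as [E1 E2].
      rewrite <- (numeral_zero _ _ E2). now apply (cell_s2 _ _ _ _ (pos_lt _) E1). }
    pose proof (cfg_next (S y) t b (cfg_running t) HC) as HN. fold i in HN.
    destruct (cfg_running (S t)) as [|HR]; [discriminate|].
    destruct (IH (k - 1)) as [E _]; [lia|].
    apply cell_s1 in E; [|apply pos_lt]. rewrite <- pos_S in E.
    replace (S (t * k + (k - 1))) with (S t * k) in E by (cbn; lia).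
    destruct E as [(_ & _ & E)|(i' & b' & r' & E & HE)]; [lia|].
    apply next_cell_true in HE as [HE|(_ & -> & _ & ->)]; [lia|].
    rewrite <- HN in E. exists b'. intros r Hr.
    pose proof (block_labels _ _ _ E r Hr) as Er. split; auto.
    destruct (IH r Hr) as [E1 E2].
    rewrite (cfg_update (S y) t b r) by (now apply HC). fold i w.
    replace (S t * k + r) with (t * k + r + k) in * by (cbn; lia).
    assert (Hn : pos (t * k + r + k) <> null).
    { intros En. rewrite En in Er.
      now rewrite (proj2 (lab_null null null_lt) eq_refl) in Er. }
    specialize (HU _ Hn _ _ _ E1). destruct (effect i b r); cbn [update].
    + now rewrite HU.
    + destruct HU as [HU1 HU2]. split; auto. now rewrite HU2.
    + rewrite HU. now apply numeral_pred.
Qed.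

(** The colour 2 singles out [u]. If [u] is null, it is already told apart by the colour 0. *)
Definition colour_diff (u x : nat) : nat := if x =? null then 0 else if x =? u then 2 else 1.

Lemma colour_diff_null u x : colour_diff u x = 0 <-> x = null.
Proof.
  unfold colour_diff. destruct (Nat.eqb_spec x null); [tauto|].
  destruct (x =? u); split; (discriminate || tauto).
Qed.

Lemma colour_diff_le u x : colour_diff u x <= 2.
Proof. unfold colour_diff. destruct (x =? null), (x =? u); lia. Qed.

Lemma colour_diff_ne u x : x <> u -> colour_diff u x <> colour_diff u u.
Proof.
  intros Hx. unfold colour_diff. rewrite (Nat.eqb_refl u).
  destruct (Nat.eqb_spec x null), (Nat.eqb_spec u null), (Nat.eqb_spec x u); congruence.
Qed.

Lemma label_pre x i b r : x < gn H -> l x = Main1 i b r -> i <= length q /\ r < k.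
Proof. intros Hx E. pose proof (lab_valid x Hx) as V. now rewrite E in V. Qed.

(* An infinite list is never rejected by [G2], as the error need not show up. *)
Lemma infinite_list_labelling :
  (forall m, pos m <> null) -> exists l2, labelling e2 valid2 Null2 Root2 H l2.
Proof.
  intros HI.
  apply (extend_labelling (colour_diff null) (colour_diff_null null) (colour_diff_le null)
    (fun x => match l x with Main1 i b r => Pre i b r | _ => Junk end)).
  - intros x i b r Hx E. rewrite E. split; [exact I|]. split; [|split; [|split]].
    + apply valid2_iff. now apply label_pre in E.
    + cbn. rewrite is_val_val, is_null_val. cbn. now apply (cell_s2 x).
    + intros E0. destruct (cell_pos _ _ _ _ Hx E) as [m ->]. destruct (HI (S m)). exact E0.
    + intros E0. destruct (cell_s1 _ _ _ _ Hx E) as [[E1 _]|(i' & b' & r' & E1 & HN)];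
        [tauto|]. now rewrite E1.
  - rewrite root_s1. cbn. now rewrite Nat.eqb_refl.
Qed.

(** * Lists that end in null *)

Section Finite.

Variable L : nat.
Hypothesis L_null : pos L = null.
Hypothesis L_least : forall m, m < L -> pos m <> null.

Definition position (x : nat) : nat :=
  match find (fun m => pos m =? x) (seq 0 L) with Some m => m | None => 0 end.

(** A repeated node would bring the end forward: after [L - m' + m] steps, fewer than [L], the list
    would be at null. *)
Lemma pos_inj m m' : m < m' -> m' < L -> pos m <> pos m'.
Proof.
  intros H1 H2 E. apply (L_least ((L - m') + m)); [lia|].
  rewrite pos_add, E, <- pos_add. now replace (L - m' + m') with L by lia.
Qed.

Lemma position_pos m : m < L -> position (pos m) = m.
Proof.
  intros Hm. unfold position.
  destruct (find (fun m0 => pos m0 =? pos m) (seq 0 L)) as [m'|] eqn:E.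
  - apply find_some in E as [E1 E2]. apply in_seq in E1. apply Nat.eqb_eq in E2.
    destruct (lt_eq_lt_dec m m') as [[H1|H1]|H1]; auto; exfalso.
    + apply (pos_inj m m'); auto; lia.
    + apply (pos_inj m' m); auto.
  - apply find_none with (x := m) in E; [|apply in_seq; lia].
    now rewrite Nat.eqb_refl in E.
Qed.

Lemma cell_before_L x i b r : x < gn H -> l x = Main1 i b r -> exists m, m < L /\ x = pos m.
Proof.
  intros Hx E. destruct (cell_pos _ _ _ _ Hx E) as [m ->]. exists m. split; auto.
  destruct (Nat.lt_ge_cases m L) as [|Hge]; auto.
  rewrite (pos_null L m Hge L_null) in E.
  now rewrite (proj2 (lab_null null null_lt) eq_refl) in E.
Qed.

(** Distinct cells before the end have distinct positions, so labels may be assigned by position: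
    [Pre] before [m], [Start] at [m], a countdown of [Err] to [m + k], then [Junk]. *)
Lemma wrong_update_labelling m :
  m + k < L -> ~ correct_update m -> exists l2, labelling e2 valid2 Null2 Root2 H l2.
Proof.
  intros Hm HW.
  destruct (pos_cell m) as [E|(i & b & r & Em)]; [now apply L_least in E; [|lia]|].
  (* The node that a correct update would lead to: the content of cell [m + k] itself must be [u],
     or its s1-successor in the case of [Up]. Singling out [u] by its colour makes the mismatch
     visible. *)
  set (u := match effect i b r with Down => s1 (s2 (pos m)) | _ => s2 (pos m) end).
  set (o := colour_diff u).
  set (inc := match effect i b r with Up => true | _ => false end).
  set (phi := fun x => let a := position x in
    if a <=? m + k then
      if a <=? m then
        match l x with
        | Main1 i b r => if a =? m then Start i b r (o u) else Pre i b r
        | _ => Junk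
        end
      else Err inc (o u) (m + k - a)
    else Junk).
  assert (P1 : forall a i b r, a < m -> l (pos a) = Main1 i b r -> phi (pos a) = Pre i b r).
  { intros a i' b' r' Ha E. unfold phi. rewrite position_pos, E by lia. cbn zeta.
    destruct (Nat.leb_spec a (m + k)); [|lia]. destruct (Nat.leb_spec a m); [|lia].
    destruct (Nat.eqb_spec a m); [lia|reflexivity]. }
  assert (P2 : phi (pos m) = Start i b r (o u)).
  { unfold phi. rewrite position_pos, Em by lia. cbn zeta.
    destruct (Nat.leb_spec m (m + k)); [|lia]. rewrite Nat.leb_refl, Nat.eqb_refl. auto. }
  assert (P3 : forall a, m < a -> a <= m + k -> phi (pos a) = Err inc (o u) (m + k - a)).
  { intros a H1 H2. unfold phi. rewrite position_pos by lia. cbn zeta.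
    destruct (Nat.leb_spec a (m + k)); [|lia]. destruct (Nat.leb_spec a m); [lia|auto]. }
  assert (P4 : forall a, m + k < a -> a < L -> phi (pos a) = Junk).
  { intros a H1 H2. unfold phi. rewrite position_pos by lia. cbn zeta.
    destruct (Nat.leb_spec a (m + k)); [lia|auto]. }
  assert (Ou := colour_diff_le u u). fold o in Ou.
  apply (extend_labelling o (colour_diff_null u) (colour_diff_le u) phi).
  - intros x i' b' r' Hx E. destruct (cell_before_L _ _ _ _ Hx E) as (a & Ha & ->).
    rewrite <- pos_S. destruct (label_pre _ _ _ _ Hx E) as [V1 V2].
    destruct (cell_s2 _ _ _ _ Hx E) as [_ HC].
    assert (Hend : S a < L -> pos (S a) <> null) by apply L_least.
    assert (Hsuc : pos (S a) <> null -> S a < L).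
    { intros E0. destruct (Nat.lt_ge_cases (S a) L) as [Hl|Hl]; auto.
      now apply (pos_null L) in Hl. }
    destruct (lt_eq_lt_dec a m) as [[Hlt| ->]|Hgt].
    + rewrite (P1 a _ _ _ Hlt E). split; [exact I|].
      split; [now apply valid2_iff|]. split; [|split].
      * cbn. now rewrite is_val_val, is_null_val.
      * intros E0. exfalso. apply Hend; auto. lia.
      * intros E0. destruct (cell_s1 _ _ _ _ Hx E) as [[E1 _]|(i1 & b1 & r1 & E1 & HN)];
          [tauto|]. rewrite <- pos_S in E1.
        destruct (Nat.eq_dec (S a) m) as [<-|Hne].
        -- rewrite P2. rewrite E1 in Em. now injection Em as -> -> ->.
        -- rewrite (P1 (S a) i1 b1 r1); auto. lia.
    + rewrite Em in E. injection E as <- <- <-. rewrite P2. split; [exact I|].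
      split; [now apply valid2_iff|]. split; [|split].
      * cbn. rewrite is_val_val, is_null_val, HC. cbn. apply Nat.eqb_eq. unfold u.
        destruct (effect i b r);
          rewrite ?colour_val, ?colour_pred_val by apply colour_diff_null; reflexivity.
      * intros E0. exfalso. apply Hend; auto. lia.
      * intros _. rewrite P3 by lia. unfold e2. rewrite (Nat.eqb_refl 1), eqb_reflx, Nat.eqb_refl.
        cbn [andb]. apply Nat.eqb_eq. lia.
    + destruct (lt_eq_lt_dec a (m + k)) as [[Hlt| ->]|Hgt2].
      * rewrite P3 by lia. split; [exact I|].
        split; [apply valid2_iff; lia|]. split; [|split].
        -- replace (m + k - a) with (S (m + k - S a)) by lia. apply is_val_val.
        -- intros E0. exfalso. apply Hend; auto. lia.
        -- intros _. rewrite P3 by lia. unfold e2.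
           rewrite (Nat.eqb_refl 1), eqb_reflx, Nat.eqb_refl. cbn [andb]. apply Nat.eqb_eq. lia.
      * rewrite P3 by lia. rewrite Nat.sub_diag. split; [exact I|].
        split; [apply valid2_iff; lia|]. split; [|split].
        -- cbn. rewrite is_val_val, is_null_val, colour_val, colour_pred_val
             by apply colour_diff_null.
           destruct (inc) eqn:Ei; cbn; [rewrite orb_true_iff|];
             rewrite negb_true_iff, Nat.eqb_neq; unfold o.
           ++ destruct (Nat.eqb_spec (s2 (pos (m + k))) null) as [|Hn]; auto.
              right. apply colour_diff_ne. intros E1. apply HW. intros i2 b2 r2 E2.
              rewrite Em in E2. injection E2 as <- <- <-. unfold inc, u in *.
              destruct (effect i b r); try discriminate. auto.
           ++ apply colour_diff_ne. intros E1. apply HW. intros i2 b2 r2 E2.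
              rewrite Em in E2. injection E2 as <- <- <-. unfold inc, u in *.
              destruct (effect i b r); try discriminate; auto.
        -- reflexivity.
        -- intros E0. rewrite P4; auto; lia.
      * rewrite P4 by lia. split; [exact I|].
        split; [now apply valid2_iff|]. split; [|split].
        -- apply is_val_val.
        -- reflexivity.
        -- intros E0. rewrite P4; auto; lia.
  - change (s1 root) with (pos 0). pose proof root_s1 as E0.
    change (s1 root) with (pos 0) in E0. destruct m as [|m].
    + rewrite P2. rewrite E0 in Em. injection Em as <- <- <-. cbn. now rewrite Nat.eqb_refl.
    + rewrite (P1 0 _ _ _ (Nat.lt_0_succ m) E0). cbn. now rewrite Nat.eqb_refl.
Qed.

End Finite.

Lemma least_pos_null m : pos m = null ->
  exists L, pos L = null /\ forall m', m' < L -> pos m' <> null.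
Proof.
  induction m as [m IH] using lt_wf_ind. intros E.
  destruct (classic (exists m', m' < m /\ pos m' = null)) as [(m' & Hm & E')|N].
  - now apply (IH m').
  - exists m. split; auto. intros m' Hm E'. apply N. eauto.
Qed.

Lemma running_labelling : exists l2, labelling e2 valid2 Null2 Root2 H l2.
Proof.
  destruct (classic (exists m, pos m = null)) as [[m Em]|N].
  - destruct (least_pos_null m Em) as (L & E & HL).
    destruct (classic (exists m', m' + k < L /\ ~ correct_update m')) as [(m' & Hm & HW)|NW].
    + now apply (wrong_update_labelling L E HL m').
    (* Block number [L] starts at position [L * k >= L], where the list has already ended, yet the
       simulation labels that position as a cell. *)
    + destruct (simulation) with (t := L) as (b & HS).
      * intros m' Hm'. destruct (classic (correct_update m')) as [|HW]; auto.
        destruct NW. exists m'. split; auto.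
        destruct (Nat.lt_ge_cases (m' + k) L) as [|Hge]; auto.
        now apply (pos_null L) in Hge.
      * destruct (HS 0 k_pos) as [E1 _]. rewrite (pos_null L) in E1; [|nia|auto].
        now rewrite (proj2 (lab_null null null_lt) eq_refl) in E1.
  - apply infinite_list_labelling. intros m Em. apply N. eauto.
Qed.

End Sound.

Lemma never_halts_implies y : ~ halts q (S y) -> implies_heaps (G1 y) G2.
Proof.
  intros HN H HH HG.
  apply (hom_iff_labelling _ _ _ _ _ _ _ _ _ (presents_G1 y) (proj1 HH)) in HG as [l Hl].
  apply (hom_iff_labelling _ _ _ _ _ _ _ _ _ presents_G2 (proj1 HH)).
  now apply (running_labelling y H l).
Qed.

(** * If the machine halts, its computation is a counterexample *)

Lemma divmod_S m :
  (S (m mod k) < k /\ S m / k = m / k /\ S m mod k = S (m mod k)) \/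
  (S (m mod k) = k /\ S m / k = S (m / k) /\ S m mod k = 0).
Proof.
  pose proof (Nat.mod_upper_bound m k ltac:(lia)) as Hb.
  pose proof (Nat.div_mod_eq m k) as Hm.
  destruct (Nat.lt_ge_cases (S (m mod k)) k) as [H|H]; [left|right]; split; auto; try lia.
  - pose proof (Nat.div_unique (S m) k (m / k) (S (m mod k)) H ltac:(lia)).
    pose proof (Nat.mod_unique (S m) k (m / k) (S (m mod k)) H ltac:(lia)). lia.
  - pose proof (Nat.div_unique (S m) k (S (m / k)) 0 k_pos ltac:(lia)).
    pose proof (Nat.mod_unique (S m) k (S (m / k)) 0 k_pos ltac:(lia)). lia.
Qed.

Lemma bounded_above (f : nat -> nat) c n : exists M, c <= M /\ forall m, m < n -> f m <= M.
Proof.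
  induction n as [|n (M & HM & HB)].
  - exists c. split; auto. lia.
  - exists (Nat.max M (f n)). split; [lia|]. intros m Hm.
    destruct (Nat.eq_dec m n) as [->|Hn]; [lia|]. specialize (HB m ltac:(lia)). lia.
Qed.

Section Trace.

Variables (y T : nat).

Definition at_cell (m : nat) : state := cfg (S y) (m / k).
Definition content (m : nat) : nat := snd (at_cell m) (m mod k).
(** The list contains the blocks 0 to [T]. The halting configuration [S T] is not written: the list
    ends where it would begin. *)
Definition len := S T * k.

(** Exceeding the input makes the numeral [top] a [NumBig], as required of the s2-pointer of the
    root. The bound on contents covers one block beyond the list, since an update claimed wrong in
    the last block refers to contents there. *)
Variable top : nat.
Hypothesis top_gt : S y < top.
Hypothesis content_le : forall m, m < len + k -> content m <= top.

(* Node 0 is null, node 1 the root, nodes [2 + m] the cells, and [nu j] the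
   numeral [j]. *)
Definition nu (j : nat) : nat := if j =? 0 then 0 else 1 + len + j.

Definition h1 (a : nat) : nat :=
  if a =? 0 then 0 else if a =? 1 then 2 else
  if a <? 2 + len then (if S a <? 2 + len then S a else 0)
  else if a =? 2 + len then 0 else pred a.

Definition h2 (a : nat) : nat :=
  if a =? 0 then 0 else if a =? 1 then nu top else
  if a <? 2 + len then nu (content (a - 2)) else 0.

Definition size := 2 + len + top.

Definition trace_heap : graph :=
  mkGraph size (map (fun a => (a, h1 a)) (seq 0 size))
    (map (fun a => (a, h2 a)) (seq 0 size)) 0 1.

Lemma edge_trace i a b : i = 1 \/ i = 2 ->
  (edge trace_heap i a b <-> a < size /\ b = if i =? 1 then h1 a else h2 a).
Proof.
  intros Hi. rewrite edge_12 by auto.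
  assert (G : forall h : nat -> nat,
    In (a, b) (map (fun a => (a, h a)) (seq 0 size)) <-> a < size /\ b = h a).
  { intros h. rewrite in_map_iff. split.
    - intros (a' & E & Ha). apply pair_equal_spec in E as [-> <-].
      apply in_seq in Ha. lia.
    - intros [Ha ->]. exists a. split; auto. apply in_seq. lia. }
  destruct Hi as [->| ->]; apply G.
Qed.

Lemma len_pos : 0 < len.
Proof. unfold len. cbn. lia. Qed.

Lemma node_cases a : a < size ->
  a = 0 \/ a = 1 \/ (exists m, m < len /\ a = 2 + m) \/
  (exists j, 1 <= j <= top /\ a = nu j).
Proof.
  unfold size. intros Ha. destruct (Nat.lt_ge_cases a 2) as [|H2]; [lia|].
  destruct (Nat.lt_ge_cases a (2 + len)) as [H3|H3].
  - right; right; left. exists (a - 2). lia.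
  - right; right; right. exists (a - 1 - len). split; [lia|]. unfold nu.
    destruct (Nat.eqb_spec (a - 1 - len) 0); lia.
Qed.

Lemma nu_pos j : 0 < j -> nu j = 1 + len + j.
Proof. unfold nu. destruct (Nat.eqb_spec j 0); lia. Qed.

Lemma nu_lt j : j <= top -> nu j < size.
Proof. unfold nu, size. destruct (j =? 0); lia. Qed.

Lemma h1_cell m : m < len -> h1 (2 + m) = if S m <? len then 2 + S m else 0.
Proof.
  intros Hm. unfold h1. cbn [Nat.eqb Nat.add].
  destruct (Nat.ltb_spec (S (S m)) (S (S len))); [|lia].
  destruct (Nat.ltb_spec (S (S (S m))) (S (S len))), (Nat.ltb_spec (S m) len); auto; lia.
Qed.

Lemma h2_cell m : m < len -> h2 (2 + m) = nu (content m).
Proof.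
  intros Hm. unfold h2. cbn [Nat.eqb Nat.add].
  destruct (Nat.ltb_spec (S (S m)) (S (S len))); [|lia].
  now replace (S (S m) - 2) with m by lia.
Qed.

Lemma h1_nu j : h1 (nu j) = nu (pred j).
Proof.
  destruct (Nat.eq_dec j 0) as [->|Hj]; [reflexivity|]. rewrite nu_pos by lia.
  unfold h1, nu. pose proof len_pos.
  destruct (Nat.eqb_spec (1 + len + j) 0); [lia|].
  destruct (Nat.eqb_spec (1 + len + j) 1); [lia|].
  destruct (Nat.ltb_spec (1 + len + j) (2 + len)); [lia|].
  destruct (Nat.eqb_spec (1 + len + j) (2 + len)), (Nat.eqb_spec (pred j) 0); lia.
Qed.

Lemma h2_nu j : h2 (nu j) = 0.
Proof.
  destruct (Nat.eq_dec j 0) as [->|Hj]; [reflexivity|]. rewrite nu_pos by lia.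
  unfold h2. pose proof len_pos.
  destruct (Nat.eqb_spec (1 + len + j) 0); [lia|].
  destruct (Nat.eqb_spec (1 + len + j) 1); [lia|].
  destruct (Nat.ltb_spec (1 + len + j) (2 + len)); [lia|reflexivity].
Qed.

Lemma h_lt i a : i = 1 \/ i = 2 -> a < size -> (if i =? 1 then h1 a else h2 a) < size.
Proof.
  pose proof len_pos. assert (S0 : 2 < size) by (unfold size; lia).
  intros Hi Ha. destruct (node_cases a Ha) as [->|[->|[(m & Hm & ->)|(j & Hj & ->)]]];
    destruct Hi as [->| ->]; cbn [Nat.eqb].
  - cbn. lia.
  - cbn. lia.
  - cbn. lia.
  - apply nu_lt. auto.
  - rewrite h1_cell by auto. destruct (Nat.ltb_spec (S m) len); unfold size; lia.
  - rewrite h2_cell by auto. apply nu_lt, content_le. lia.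
  - rewrite h1_nu. apply nu_lt. lia.
  - rewrite h2_nu. lia.
Qed.

Lemma trace_is_heap : is_heap trace_heap.
Proof.
  pose proof len_pos. assert (S0 : 2 < size) by (unfold size; lia).
  split; [|split].
  - split; [cbn; lia|]. split; [cbn; lia|]. split; [cbn; lia|]. split.
    + intros i a b Hi He. apply edge_trace in He as [Ha ->]; auto.
      split; auto. now apply h_lt.
    + intros i x Hi Hx. rewrite edge_trace by auto. cbn [gnull trace_heap].
      destruct Hi as [->| ->]; cbn; intuition lia.
  - intros i a Hi Ha. exists (if i =? 1 then h1 a else h2 a). split.
    + now apply edge_trace.
    + intros b Hb. now apply edge_trace in Hb.
  - cbn [gn gnull trace_heap].
    assert (R1 : reach trace_heap 1) by apply reach_root.
    intros a Ha Hn. destruct (node_cases a Ha) as [->|[->|[(m & Hm & ->)|(j & Hj & ->)]]];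
      auto; [lia| |].
    + induction m as [|m IH].
      * apply (reach_step _ 1 1); auto. apply edge_trace; auto. split; [lia|reflexivity].
      * apply (reach_step _ 1 (2 + m)); auto; [apply IH; lia|].
        apply edge_trace; auto. split; [lia|]. cbn [Nat.eqb]. rewrite h1_cell by lia.
        destruct (Nat.ltb_spec (S m) len); lia.
    (* Numerals are reached from the largest one downwards, starting with the s2-pointer of the
       root. *)
    + assert (G : forall d, d <= top -> reach trace_heap (nu (top - d)) \/ top <= d).
      { induction d as [|d IH]; intros Hd.
        - left. rewrite Nat.sub_0_r. apply (reach_step _ 2 1); auto.
          apply edge_trace; auto. split; [lia|reflexivity].
        - destruct IH as [IH|IH]; [lia| |lia]. left. apply (reach_step _ 1 (nu (top - d))); auto.
          apply edge_trace; auto. split; [apply nu_lt; lia|]. cbn [Nat.eqb].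
          rewrite h1_nu. f_equal. lia. }
      destruct (G (top - j)) as [G1'|G1']; [lia| |lia].
      now replace (top - (top - j)) with j in G1' by lia.
Qed.

Hypothesis running : forall t, t <= T -> t = 0 \/ fst (cfg (S y) t) < length q.

Lemma running_at_cell m : m < len -> m / k = 0 \/ fst (at_cell m) < length q.
Proof.
  intros Hm. apply running. pose proof (Nat.Div0.div_lt_upper_bound m k (S T)) as HD.
  unfold len in Hm. enough (m / k < S T) by lia. apply HD; lia.
Qed.

Lemma mod_lt m : m mod k < k.
Proof. apply Nat.mod_upper_bound. lia. Qed.

Definition trace_lab1 (a : nat) : lab1 :=
  if a =? 0 then Null1 else if a =? 1 then Root1 else
  if a <? 2 + len then
    Main1 (fst (at_cell (a - 2))) (guess (at_cell (a - 2))) ((a - 2) mod k)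
  else if a - 1 - len <=? S y then NumJ (a - 1 - len) else NumBig.

Lemma trace_lab1_cell m : m < len ->
  trace_lab1 (2 + m) = Main1 (fst (at_cell m)) (guess (at_cell m)) (m mod k).
Proof.
  intros Hm. unfold trace_lab1. cbn [Nat.eqb Nat.add].
  destruct (Nat.ltb_spec (S (S m)) (S (S len))); [|lia].
  now replace (S (S m) - 2) with m by lia.
Qed.

Lemma trace_lab1_nu j : 0 < j ->
  trace_lab1 (nu j) = if j <=? S y then NumJ j else NumBig.
Proof.
  intros Hj. rewrite nu_pos by auto. unfold trace_lab1. pose proof len_pos.
  destruct (Nat.eqb_spec (1 + len + j) 0); [lia|].
  destruct (Nat.eqb_spec (1 + len + j) 1); [lia|].
  destruct (Nat.ltb_spec (1 + len + j) (2 + len)); [lia|].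
  now replace (1 + len + j - 1 - len) with j by lia.
Qed.

Lemma guess_all m : m < len -> forall r,
  consistent (fst (at_cell m)) (guess (at_cell m)) r (snd (at_cell m) r =? 0) = true.
Proof. intros Hm r. apply guess_consistent. now apply running_at_cell. Qed.

Lemma next_block m b : m < len ->
  (forall s, s < k -> consistent (fst (at_cell m)) b s (snd (at_cell m) s =? 0) = true) ->
  next_instr (fst (at_cell m)) b = fst (cfg (S y) (S (m / k))).
Proof. intros Hm HC. symmetry. apply cfg_next; auto. now apply running_at_cell. Qed.

(** The guess [b] of a labelling into [G2] need not be [guess]: before the tested register it may
    still be wrong. At the end of a block all registers have been checked, and only then is it used
    for the jump. *)
Lemma next_cell_trace m b : S m < len ->
  (forall s, s <= m mod k ->
    consistent (fst (at_cell m)) b s (snd (at_cell m) s =? 0) = true) ->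
  forall i' b' r', next_cell (fst (at_cell m)) b (m mod k) i' b' r' = true ->
  i' = fst (at_cell (S m)) /\ r' = S m mod k /\ (r' = 0 \/ b' = b /\ m / k = S m / k).
Proof.
  intros Hm HC i' b' r' HN. apply next_cell_true in HN.
  destruct (divmod_S m) as [(H1 & H2 & H3)|(H1 & H2 & H3)].
  - destruct HN as [(_ & -> & -> & ->)|HN]; [|lia]. unfold at_cell.
    rewrite H2, H3. auto.
  - destruct HN as [HN|(_ & -> & _ & ->)]; [lia|]. unfold at_cell at 2.
    rewrite H2, H3. split; auto. apply next_block; [lia|]. intros s Hs. apply HC. lia.
Qed.

Lemma content_update m b :
  consistent (fst (at_cell m)) b (m mod k) (content m =? 0) = true ->
  content (m + k) = update (effect (fst (at_cell m)) b (m mod k)) (content m).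
Proof.
  intros HC. unfold content at 1, at_cell at 1.
  replace (m + k) with (m + 1 * k) by lia.
  rewrite Nat.div_add, Nat.Div0.mod_add by lia. rewrite Nat.add_1_r.
  now apply cfg_update.
Qed.

(** Any claim of an error is refuted when its countdown ends, so [Junk] is never entered, and no
    other label is available that lets the last cell point to null. *)
Lemma no_trace_labelling2 l2 : ~ labelling e2 valid2 Null2 Root2 trace_heap l2.
Proof.
  pose proof len_pos as LP. assert (S0 : 2 < size) by (unfold size; lia).
  intros (HV & HE & HRoot & HNull).
  assert (E1 : forall a, a < size -> e2 1 (l2 a) (l2 (h1 a)) = true).
  { intros a Ha. apply HE; auto. apply edge_trace; auto. }
  assert (E2 : forall a, a < size -> e2 2 (l2 a) (l2 (h2 a)) = true).
  { intros a Ha. apply HE; auto. apply edge_trace; auto. }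
  assert (LN : l2 0 = Null2) by (apply HNull; [change (0 < size); lia|reflexivity]).
  assert (LNu : forall j, j <= top -> is_null (l2 (nu j)) = (j =? 0)).
  { intros j Hj. destruct (Nat.eqb_spec j 0) as [->|Hn].
    - change (nu 0) with 0. now rewrite LN.
    - destruct (l2 (nu j)) eqn:E; auto. apply HNull in E; [|now apply nu_lt].
      cbn in E. rewrite nu_pos in E; lia. }
  assert (LR : l2 1 = Root2).
  { apply HRoot; [change (1 < size); lia|reflexivity]. }
  (* Numerals are forced to carry [Val] labels from the top down: the s2-pointer of the root must be
     a value, and values pass this on along s1. *)
  assert (LVal : forall d, d <= top -> is_val (l2 (nu (top - d))) = true).
  { induction d as [|d IH]; intros Hd.
    - rewrite Nat.sub_0_r. specialize (E2 1 ltac:(lia)). now rewrite LR in E2.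
    - specialize (IH ltac:(lia)). specialize (E1 _ (nu_lt (top - d) ltac:(lia))).
      rewrite h1_nu in E1. replace (pred (top - d)) with (top - S d) in E1 by lia.
      destruct (l2 (nu (top - d))), (l2 (nu (top - S d))); cbn in *; congruence. }
  assert (LP1 : forall j, j <= top ->
    colour_pred (l2 (nu j)) = colour (l2 (nu (pred j)))).
  { intros j Hj. pose proof (LVal (top - j) ltac:(lia)) as HVal.
    replace (top - (top - j)) with j in HVal by lia. specialize (E1 (nu j) (nu_lt j Hj)).
    rewrite h1_nu in E1.
    destruct (l2 (nu j)), (l2 (nu (pred j))); cbn in *; try discriminate; auto;
      symmetry; apply Nat.eqb_eq; auto; now rewrite Nat.eqb_sym. }
  assert (CS : forall m, m < len -> 2 + m < size) by (unfold size; lia).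
  (* Either no error has been claimed and the labels follow the true computation, with a guess
     consistent with the registers passed so far; or one has been claimed [d] cells ahead, with a
     colour [c] that the content there matches. *)
  set (J := fun m =>
    (exists b, (l2 (2 + m) = Pre (fst (at_cell m)) b (m mod k) \/
                exists c, l2 (2 + m) = Start (fst (at_cell m)) b (m mod k) c) /\
       forall s, s < m mod k ->
         consistent (fst (at_cell m)) b s (snd (at_cell m) s =? 0) = true) \/
    (exists inc c d, l2 (2 + m) = Err inc c d /\ m + d < len + k /\
       c = (if inc then colour_pred else colour) (l2 (nu (content (m + d)))) /\
       (inc = true -> content (m + d) <> 0))).
  assert (J0 : J 0).
  { left. specialize (E1 1 ltac:(lia)). change (h1 1) with (2 + 0) in E1.
    rewrite LR in E1.
    unfold at_cell. rewrite Nat.Div0.div_0_l, Nat.Div0.mod_0_l. cbn [cfg fst].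
    destruct (l2 (2 + 0)) as [| | |i b r|i b r c| |]; cbn in E1; try discriminate;
      apply andb_true_iff in E1 as [E3 E4]; apply Nat.eqb_eq in E3, E4; subst i r;
      exists b; (split; [eauto|lia]). }
  (* At a cell that [l2] has not declared to lie past an error, the guess is
     consistent up to and including that cell. *)
  assert (JC : forall m b, m < len ->
    (l2 (2 + m) = Pre (fst (at_cell m)) b (m mod k) \/
     exists c, l2 (2 + m) = Start (fst (at_cell m)) b (m mod k) c) ->
    consistent (fst (at_cell m)) b (m mod k) (content m =? 0) = true).
  { intros m b Hm HL. specialize (E2 _ (CS m Hm)). rewrite h2_cell in E2 by auto.
    rewrite <- LNu by (apply content_le; lia).
    destruct HL as [HL|[c HL]]; rewrite HL in E2; cbn in E2;
      rewrite !andb_true_iff in E2; tauto. }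
  assert (JE : forall m inc c, m < len -> l2 (2 + m) = Err inc c 0 ->
    c = (if inc then colour_pred else colour) (l2 (nu (content m))) ->
    (inc = true -> content m <> 0) -> False).
  { intros m inc c Hm HL Hc Hi. specialize (E2 _ (CS m Hm)).
    rewrite h2_cell, HL in E2 by auto. cbn in E2. apply andb_true_iff in E2 as [_ E2].
    destruct inc.
    - rewrite LNu in E2 by (apply content_le; lia). subst c.
      rewrite Nat.eqb_refl in E2. specialize (Hi eq_refl). apply Nat.eqb_neq in Hi.
      rewrite Hi in E2. discriminate.
    - subst c. rewrite Nat.eqb_refl in E2. discriminate. }
  assert (JS : forall m, S m < len -> J m -> J (S m)).
  { intros m Hm HJ. assert (Hm' : m < len) by lia.
    specialize (E1 _ (CS m Hm')). rewrite h1_cell in E1 by auto.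
    destruct (Nat.ltb_spec (S m) len) as [_|]; [|lia].
    destruct HJ as [(b & HL & HC)|(inc & c & d & HL & Hd & Hc & Hi)].
    - pose proof (JC m b Hm' HL) as HC'.
      assert (HCr : forall s, s <= m mod k ->
        consistent (fst (at_cell m)) b s (snd (at_cell m) s =? 0) = true).
      { intros s Hs. destruct (Nat.eq_dec s (m mod k)) as [->|Hn]; auto.
        apply HC. lia. }
      destruct HL as [HL|[c HL]]; rewrite HL in E1.
      + assert (HN : exists b' , (l2 (2 + S m) = Pre (fst (at_cell (S m))) b' (S m mod k) \/
            exists c, l2 (2 + S m) = Start (fst (at_cell (S m))) b' (S m mod k) c) /\
            (S m mod k = 0 \/ b' = b /\ m / k = S m / k)).
        { destruct (l2 (2 + S m)) as [| | |i' b' r'|i' b' r' c| |]; cbn in E1;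
            try discriminate;
            destruct (next_cell_trace m b Hm HCr _ _ _ E1) as (-> & -> & HB); eauto. }
        destruct HN as (b' & HL' & HB). left. exists b'. split; auto. intros s Hs.
        destruct HB as [HB|[-> HB]]; [lia|]. unfold at_cell. rewrite <- HB.
        apply HCr. destruct (divmod_S m) as [H1|H1]; lia.
      + destruct (l2 (2 + S m)) as [| | | | |inc c' d|] eqn:HL'; try discriminate.
        unfold e2 in E1. rewrite (Nat.eqb_refl 1), !andb_true_iff in E1.
        destruct E1 as [[Einc Ec] Ed]. apply Nat.eqb_eq in Ec, Ed. apply eqb_prop in Einc.
        subst c'. right. exists inc, c, d. split; auto. split; [lia|].
        replace (S m + d) with (m + k) by lia.
        pose proof (content_update m b HC') as HU.
        assert (Hle := content_le m ltac:(lia)).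
        assert (Hle' := content_le (m + k) ltac:(lia)).
        specialize (E2 _ (CS m Hm')). rewrite HL, h2_cell in E2 by auto.
        cbn in E2. rewrite !andb_true_iff in E2. destruct E2 as [[HVal _] Ecol].
        apply Nat.eqb_eq in Ecol. subst inc.
        (* The claimed colour is the true one: after an increment the old content is the predecessor
           of the new one, after a decrement it is the other way round. *)
        destruct (effect (fst (at_cell m)) b (m mod k)); cbn [update] in HU; rewrite HU.
        * split; [exact Ecol|discriminate].
        * split; [|discriminate]. rewrite LP1; [exact Ecol|lia].
        * split; [|discriminate]. rewrite Ecol. now apply LP1.
    - destruct d as [|d].
      + exfalso. rewrite Nat.add_0_r in *. eapply JE; eauto.
      + rewrite HL in E1. destruct (l2 (2 + S m)) as [| | | | |inc' c' d'|] eqn:HL';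
          cbn in E1; try discriminate.
        rewrite !andb_true_iff in E1. destruct E1 as [[Ei Ec] Ed].
        apply Nat.eqb_eq in Ec, Ed. apply eqb_prop in Ei. subst inc' c' d'.
        right. exists inc, c, d. replace (S m + d) with (m + S d) by lia. auto. }
  assert (JA : forall m, m < len -> J m).
  { induction m as [|m IH]; intros Hm; auto. apply JS; auto. apply IH. lia. }
  assert (Hl : len - 1 < len) by lia.
  specialize (E1 _ (CS _ Hl)). rewrite h1_cell in E1 by auto.
  destruct (Nat.ltb_spec (S (len - 1)) len); [lia|]. rewrite LN in E1.
  destruct (JA _ Hl) as [(b & [HL|[c HL]] & _)|(inc & c & d & HL & _ & Hc & Hi)];
    rewrite HL in E1; try discriminate.
  destruct d as [|d]; [|discriminate]. rewrite Nat.add_0_r in *. eapply JE; eauto.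
Qed.

Hypothesis stopped : length q <= fst (cfg (S y) (S T)).

Lemma trace_labelling1 :
  labelling (e1 (S y)) (valid1 (S y)) Null1 Root1 trace_heap trace_lab1.
Proof.
  pose proof len_pos as LP. assert (S0 : 2 < size) by (unfold size; lia).
  split; [|split; [|split]].
  - intros a Ha. destruct (node_cases a Ha) as [->|[->|[(m & Hm & ->)|(j & Hj & ->)]]];
      try exact I.
    + rewrite trace_lab1_cell by auto. split; [|apply mod_lt].
      destruct (running_at_cell m Hm) as [E|]; [|lia]. unfold at_cell. rewrite E. cbn. lia.
    + rewrite trace_lab1_nu by lia. destruct (Nat.leb_spec j (S y)); cbn; lia.
  - intros i a b Hi He. apply edge_trace in He as [Ha ->]; auto.
    destruct (node_cases a Ha) as [->|[->|[(m & Hm & ->)|(j & Hj & ->)]]];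
      destruct Hi as [->| ->]; cbn [Nat.eqb].
    + reflexivity.
    + reflexivity.
    + change (h1 1) with (2 + 0). rewrite trace_lab1_cell by auto. unfold at_cell.
      rewrite Nat.Div0.div_0_l, Nat.Div0.mod_0_l. unfold guess. cbn [cfg fst].
      rewrite (proj2 (nth_error_None q (length q)) (le_n _)). cbn.
      now rewrite Nat.eqb_refl.
    + change (h2 1) with (nu top). rewrite trace_lab1_nu by lia.
      destruct (Nat.leb_spec top (S y)); [lia|reflexivity].
    + rewrite h1_cell, trace_lab1_cell by auto. destruct (Nat.ltb_spec (S m) len) as [HS|HS].
      * rewrite trace_lab1_cell by auto. cbn. apply next_cell_true.
        destruct (divmod_S m) as [(H1 & H2 & H3)|(H1 & H2 & H3)].
        -- left. unfold at_cell. rewrite H2, H3. auto.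
        -- right. rewrite (next_block m) by (auto using guess_all).
           unfold at_cell at 1 2. rewrite H2, H3. split; [lia|]. split; auto. split; auto.
           destruct (running_at_cell (S m) HS) as [E|E]; [lia|].
           unfold at_cell in E. now rewrite H2 in E.
      * cbn. apply last_cell_true. rewrite (next_block m) by (auto using guess_all).
        assert (Em : m = T * k + (k - 1)) by (unfold len in *; cbn in *; lia).
        assert (ED : m / k = T).
        { symmetry. apply (Nat.div_unique m k T (k - 1)); lia. }
        assert (EM : m mod k = k - 1).
        { symmetry. apply (Nat.mod_unique m k T (k - 1)); lia. }
        rewrite ED, EM. split; [lia|exact stopped].
    + rewrite h2_cell, trace_lab1_cell by auto.
      pose proof (guess_all m Hm (m mod k)) as HC. fold (content m) in HC.
      destruct (Nat.eq_dec (content m) 0) as [E0|E0].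
      * rewrite E0 in *. exact HC.
      * rewrite trace_lab1_nu by lia. apply Nat.eqb_neq in E0 as E0'. rewrite E0' in HC.
        destruct (running_at_cell m Hm) as [ED|ED].
        -- assert (EC : content m = if m mod k =? 0 then S y else 0).
           { unfold content, at_cell. rewrite ED. reflexivity. }
           destruct (m mod k =? 0) eqn:EM; [|lia].
           destruct (Nat.leb_spec (content m) (S y)); [|lia].
           unfold at_cell. rewrite ED. cbn. unfold guess. cbn [fst].
           rewrite (proj2 (nth_error_None q (length q)) (le_n _)), Nat.eqb_refl, EM, EC.
           cbn. apply Nat.eqb_refl.
        -- destruct (content m <=? S y); cbn;
             destruct (Nat.eqb_spec (fst (at_cell m)) (length q)); try lia; auto.
           rewrite HC. reflexivity.
    + rewrite h1_nu. rewrite (trace_lab1_nu j) by lia.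
      destruct (Nat.eq_dec j 1) as [->|Hj1]; [reflexivity|].
      rewrite trace_lab1_nu by lia.
      destruct (Nat.leb_spec j (S y)), (Nat.leb_spec (pred j) (S y)); cbn; try lia; auto.
      * apply Nat.eqb_eq. lia.
      * apply Nat.eqb_eq. lia.
    + rewrite h2_nu, trace_lab1_nu by lia. destruct (j <=? S y); reflexivity.
  - intros a Ha. cbn [groot trace_heap].
    destruct (node_cases a Ha) as [->|[->|[(m & Hm & ->)|(j & Hj & ->)]]].
    + split; discriminate.
    + split; reflexivity.
    + rewrite trace_lab1_cell by auto. split; discriminate.
    + rewrite trace_lab1_nu, nu_pos by lia.
      destruct (j <=? S y); (split; [discriminate|lia]).
  - intros a Ha. cbn [gnull trace_heap].
    destruct (node_cases a Ha) as [->|[->|[(m & Hm & ->)|(j & Hj & ->)]]].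
    + split; reflexivity.
    + split; discriminate.
    + rewrite trace_lab1_cell by auto. split; discriminate.
    + rewrite trace_lab1_nu, nu_pos by lia.
      destruct (j <=? S y); (split; [discriminate|lia]).
Qed.

End Trace.

Lemma first_halting_time p x : halts p x ->
  exists T, halted p (run p T (init_state x)) /\
    forall t, t < T -> ~ halted p (run p t (init_state x)).
Proof.
  intros [T HT]. induction T as [T IH] using lt_wf_ind.
  destruct (classic (exists t, t < T /\ halted p (run p t (init_state x))))
    as [(t & Ht & Hh)|N].
  - exact (IH t Ht Hh).
  - exists T. split; auto. intros t Ht Hh. apply N. eauto.
Qed.

Lemma halts_not_implies y : halts q (S y) -> ~ implies_heaps (G1 y) G2.
Proof.
  intros HT HI. destruct (first_halting_time _ _ HT) as (T & Hstop & Hrun).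
  destruct (bounded_above (content y) (S (S y)) (len T + k)) as (top & Htop & Hle).
  assert (running : forall t, t <= T -> t = 0 \/ fst (cfg (S y) t) < length q).
  { intros [|t] Ht; [auto|]. right. cbn [cfg]. specialize (Hrun t ltac:(lia)).
    unfold halted in Hrun. lia. }
  assert (Hheap := trace_is_heap y T top Htop Hle).
  assert (HG1 := ex_intro _ _ (trace_labelling1 y T top Htop running Hstop)).
  apply (hom_iff_labelling _ _ _ _ _ _ _ _ _ (presents_G1 y) (proj1 Hheap)) in HG1.
  apply (HI _ Hheap) in HG1.
  apply (hom_iff_labelling _ _ _ _ _ _ _ _ _ presents_G2 (proj1 Hheap)) in HG1 as [l2 Hl2].
  exact (no_trace_labelling2 y T top Htop Hle running l2 Hl2).
Qed.

Lemma implies_iff_not_halts y : implies_heaps (G1 y) G2 <-> ~ halts q (S y).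
Proof.
  split.
  - intros HI HT. exact (halts_not_implies y HT HI).
  - apply never_halts_implies.
Qed.

End Reduction.

(** * Diagonalization *)

Definition cons_code (a b c : nat) : nat := S (cpair (cpair a b) c).

(** The code of a list with a new head depends only on that head and on the code of the tail, so the
    loops that build the chains also act on codes. *)
Definition chain1_code (B y c : nat) : nat :=
  cons_code 3 (B + y) (down y (fun j v => cons_code (B + j + 1) (B + j) v) c).

Definition chain2_code (B R y c : nat) : nat :=
  cons_code 2 (B + y)
    (down (S y) (fun j v =>
       down R (fun i v => cons_code (i + 4) (B + j) v) (cons_code (B + j) 0 v)) c).

Lemma enc_down n (g : nat -> nat * nat) L :
  enc_pairs (down n (fun j L => g j :: L) L) =
  down n (fun j v => cons_code (fst (g j)) (snd (g j)) v) (enc_pairs L).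
Proof.
  revert L. induction n as [|n IH]; intros L; cbn [down]; auto.
  rewrite IH. cbn [enc_pairs]. destruct (g n); reflexivity.
Qed.

Lemma enc_chain1 B y L : enc_pairs (chain1 B y L) = chain1_code B y (enc_pairs L).
Proof.
  unfold chain1, chain1_code. cbn [enc_pairs].
  now rewrite (enc_down y (fun j => (B + j + 1, B + j))).
Qed.

Lemma enc_chain2 B R y L : enc_pairs (chain2 B R y L) = chain2_code B R y (enc_pairs L).
Proof.
  unfold chain2, chain2_code. cbn [enc_pairs]. unfold cons_code at 1. do 2 f_equal.
  generalize (S y). intros n. revert L. induction n as [|n IH]; intros L; cbn [down]; auto.
  rewrite IH. now rewrite (enc_down R (fun i => (i + 4, B + n))).
Qed.

(** Here [y] is used twice: it is decoded into the fixed part of an instance, and it determines the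
    length of the chain of numerals. *)
Definition instance_code (y : nat) : nat :=
  let B := cproj1 y in
  let R := cproj1 (cproj2 y) in
  let c1 := cproj1 (cproj2 (cproj2 y)) in
  let c2 := cproj1 (cproj2 (cproj2 (cproj2 y))) in
  let g2 := cproj2 (cproj2 (cproj2 (cproj2 y))) in
  cpair (cpair (B + S y)
    (cpair (chain1_code B y c1) (cpair (chain2_code B R y c2) (cpair 0 1)))) g2.

(* The part of the instance of [q] that does not depend on the input. *)
Definition self_code (q : list instr) (k : nat) : nat :=
  cpair (base q k) (cpair (length (wide_labs q k))
    (cpair (enc_pairs (base_edges1 q k))
      (cpair (enc_pairs (base_edges2 q k)) (enc_graph (G2 q k))))).

(** The self-reference: decoding the code of the fixed part and adding the chain for that same
    number yields the instance that speaks about [q] on its own code. *)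
Lemma instance_code_self q k :
  instance_code (self_code q k) = enc_instance (G1 q k (self_code q k)) (G2 q k).
Proof.
  set (y := self_code q k).
  assert (P1 : cproj1 y = base q k) by (unfold y, self_code; now rewrite cproj1_cpair).
  assert (P2 : cproj1 (cproj2 y) = length (wide_labs q k))
    by (unfold y, self_code; now rewrite cproj2_cpair, cproj1_cpair).
  assert (P3 : cproj1 (cproj2 (cproj2 y)) = enc_pairs (base_edges1 q k))
    by (unfold y, self_code; now rewrite !cproj2_cpair, cproj1_cpair).
  assert (P4 : cproj1 (cproj2 (cproj2 (cproj2 y))) = enc_pairs (base_edges2 q k))
    by (unfold y, self_code; now rewrite !cproj2_cpair, cproj1_cpair).
  assert (P5 : cproj2 (cproj2 (cproj2 (cproj2 y))) = enc_graph (G2 q k))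
    by (unfold y, self_code; now rewrite !cproj2_cpair).
  (* As [y] also occurs as the input, it is made opaque, and only its projections are replaced. *)
  clearbody y. unfold enc_instance, enc_graph at 1. cbn [G1 gn gs1 gs2 gnull groot].
  unfold instance_code. now rewrite enc_chain1, enc_chain2, P1, P2, P3, P4, P5.
Qed.

Lemma computable_cons_code f g h :
  computable f -> computable g -> computable h ->
  computable (fun l => cons_code (f l) (g l) (h l)).
Proof.
  intros Hf Hg Hh. apply computable_succ, computable_cpair; auto.
  now apply computable_cpair.
Qed.

Lemma computable_tl2 f : computable f -> computable (fun l => f (tl (tl l))).
Proof. intros Hf. apply (computable_tl (fun l => f (tl l))). now apply computable_tl. Qed.

Lemma computable_chain1 B y c :
  computable B -> computable y -> computable c ->
  computable (fun l => chain1_code (B l) (y l) (c l)).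
Proof.
  intros HB Hy Hc. apply computable_cons_code.
  - apply computable_const.
  - now apply computable_add.
  - apply (computable_down y c (fun j v l => cons_code (B l + j + 1) (B l + j) v)); auto.
    assert (HB2 := computable_tl2 B HB).
    assert (Hj := computable_add _ _ HB2 (computable_var 0)).
    apply computable_cons_code; auto using computable_var.
    apply (computable_add _ _ Hj (computable_const 1)).
Qed.

Lemma computable_chain2 B R y c :
  computable B -> computable R -> computable y -> computable c ->
  computable (fun l => chain2_code (B l) (R l) (y l) (c l)).
Proof.
  intros HB HR Hy Hc. apply computable_cons_code.
  - apply computable_const.
  - now apply computable_add.
  - apply (computable_down (fun l => S (y l)) c (fun j v l =>
      down (R l) (fun i v => cons_code (i + 4) (B l + j) v) (cons_code (B l + j) 0 v)));
      auto using computable_succ.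
    assert (HB2 := computable_tl2 B HB). assert (HR2 := computable_tl2 R HR).
    assert (Hj := computable_add _ _ HB2 (computable_var 0)).
    apply (computable_down (fun l => R (tl (tl l)))
      (fun l => cons_code (B (tl (tl l)) + nth 0 l 0) 0 (nth 1 l 0))
      (fun i v l => cons_code (i + 4) (B (tl (tl l)) + nth 0 l 0) v)); auto.
    + apply computable_cons_code; auto using computable_var, computable_const.
    + apply computable_cons_code; auto using computable_var.
      * apply (computable_add _ _ (computable_var 0) (computable_const 4)).
      * apply (computable_tl2 (fun l => B (tl (tl l)) + nth 0 l 0) Hj).
Qed.

Lemma computable_instance_code : computable (fun l => instance_code (pred (nth 0 l 0))).
Proof.
  assert (Hy := computable_pred _ (computable_var 0)).
  unfold instance_code.
  repeat (apply computable_cpair || apply computable_chain1 || apply computable_chain2 ||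
    apply computable_cproj1 || apply computable_cproj2 || apply computable_add ||
    apply computable_succ || apply computable_const || exact Hy).
Qed.

Lemma register_bound (q : list instr) :
  exists k, 0 < k /\ forall i ins, nth_error q i = Some ins ->
    match ins with INC r | DEC r _ => r < k end.
Proof.
  induction q as [|ins q (k & Hk & IH)].
  - exists 1. split; [lia|]. intros [|i] ins; discriminate.
  - set (r := match ins with INC r | DEC r _ => r end).
    exists (Nat.max k (S r)). split; [lia|]. intros [|i] ins'; cbn.
    + intros [= <-]. unfold r. destruct ins; lia.
    + intros E. apply IH in E. destruct ins'; lia.
Qed.

Theorem theorem38 : ~ exists p : list instr, decides_heap_implication p.
Proof.
  intros [p Hp].
  destruct (halts_iff_outputs_true (fun x => instance_code (pred x)) p
    computable_instance_code) as [q Hq].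
  destruct (register_bound q) as (k & Hk & Hregs).
  (* The program [q] is fixed before [y]: it does not contain its own code but receives it as
     input. *)
  set (y := self_code q k).
  destruct (Hp (G1 q k y) (G2 q k)) as (b & Hout & Hb).
  - now apply wf_G1.
  - now apply wf_G2.
  - unfold y in Hout at 1. rewrite <- instance_code_self in Hout. fold y in Hout.
    specialize (Hq (S y) b Hout).
    pose proof (implies_iff_not_halts q k Hk Hregs y). tauto.
Qed.
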